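(* Let $p,q$ be positive integers with $\frac1p+\frac1q=\frac12$, and put $C=\frac32(p-1)(q+1)$. Let $M$ be a finite $(p,q)$-map of perimeter $n$, and let $r\ge 0$ be such that $M$ contains no simple flat submap of radius greater than $r$. Then the area of $M$ (the number of its faces) satisfies $\mathrm{Area}(M)\le C(r+p)n$.
   Context: A map is a finite, connected, simply connected 2-complex embedded in the Euclidean plane; its cells of dimension $0,1,2$ are vertices, edges, faces. The degree $d(o)$ of a vertex $o$ is the number of oriented edges starting at $o$ (a loop contributes 2). The degree $d(\Pi)$ of a face $\Pi$ is the length of its closed boundary path; the perimeter of a map is the length of its closed boundary path. An edge/vertex is exterior if it lies on the boundary path of the map, and a face is exterior if its boundary shares an edge with the boundary of the map; non-exterior cells are interior. A $(p,q)$-map is a map in which every interior face has degree at least $p$ and every interior vertex has degree at least $q$. A submap of $M$ is the subcomplex bounded by a closed curve which can be made simple by an arbitrarily small deformation; it is simple if it is bounded by a simple closed curve. A submap is flat if each of its faces has degree exactly $p$ and each of its interior vertices has degree exactly $q$. The radius of a map is the maximal (combinatorial) distance from a vertex to the boundary of the map. *)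

(* Defs.v *)
From mathcomp Require Import all_boot all_order all_algebra all_fingroup.
Set Implicit Arguments. Unset Strict Implicit. Unset Printing Implicit Defensive.
Import Order.TTheory GRing.Theory Num.Theory.

(* A map is encoded by a finite set D of darts (oriented edges),
   a fixed-point-free involution [alpha] (the two orientations of an edge)
   and a permutation [sigma] (cyclic order of darts starting at a vertex).
   Vertices are sigma-orbits, edges are alpha-orbits, and the boundary walks
   of the regions are the orbits of phi := sigma \o alpha.  A dart [o]
   selects the unbounded (outer) region, whose orbit is the boundary path
   of the map; the other phi-orbits are the faces of the map. *)

Section Maps.
Variables (D : finType) (alpha sigma : {perm D}).

Definition phi (d : D) : D := sigma (alpha d).

Definition vertex_of (d : D) : {set D} := [set y | fconnect sigma d y].
Definition face_of (d : D) : {set D} := [set y | fconnect phi d y].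

Definition vertices : {set {set D}} := [set vertex_of d | d : D].
Definition regions : {set {set D}} := [set face_of d | d : D].

(* finite, connected, and embedded in the sphere (Euler characteristic 2);
   removing one region of such a sphere map gives exactly the finite,
   connected, simply connected plane 2-complexes. *)
Definition is_map : Prop :=
  [/\ forall d, alpha d != d,
      forall d, alpha (alpha d) = d,
      forall x y, connect [rel a b | (b == sigma a) || (b == alpha a)] x y
    & 2 * (#|vertices| + #|regions|) = #|D| + 4].

Variable o : D.

Definition outer : {set D} := face_of o.
Definition faces : {set {set D}} := regions :\ outer.
Definition area : nat := #|faces|.
Definition perimeter : nat := #|outer|.

Definition interior_face (F : {set D}) : bool :=
  (F \in faces) && [forall x in F, alpha x \notin outer].
Definition interior_vertex (V : {set D}) : bool :=
  (V \in vertices) && [forall x in V, x \notin outer].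

Definition pq_map (p q : nat) : Prop :=
  (forall F, interior_face F -> p <= #|F|) /\
  (forall V, interior_vertex V -> q <= #|V|).

(* Submaps, given by the set S of darts of their faces. *)
Definition submap_region (S : {set D}) : bool :=
  [forall x in S, face_of x \subset S] && [disjoint S & outer].

Definition bdarts (S : {set D}) : {set D} := [set x in S | alpha x \notin S].

Definition simple_boundary (S : {set D}) : Prop :=
  exists s : seq D,
    [/\ s != [::], uniq s, [set x in s] = bdarts S,
        path.cycle [rel a b | b \in vertex_of (alpha a)] s
      & uniq (map vertex_of s)].

Definition simple_submap (S : {set D}) : Prop :=
  submap_region S /\ simple_boundary S.

Definition sub_vertices (S : {set D}) : {set {set D}} :=
  [set vertex_of x | x in S].
Definition sub_bvertices (S : {set D}) : {set {set D}} :=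
  [set vertex_of x | x in bdarts S].

Definition flat (p q : nat) (S : {set D}) : Prop :=
  (forall x, x \in S -> #|face_of x| = p) /\
  (forall V, V \in sub_vertices S -> V \notin sub_bvertices S -> #|V| = q).

Definition sub_edge (S : {set D}) (x : D) : bool := (x \in S) || (alpha x \in S).

Fixpoint reach (S : {set D}) (k : nat) (V : {set D}) : Prop :=
  match k with
  | 0 => V \in sub_bvertices S
  | k'.+1 => reach S k' V \/
      exists x, [/\ x \in V, sub_edge S x & reach S k' (vertex_of (alpha x))]
  end.

Definition radius_le (R : numDomainType) (S : {set D}) (r : R) : Prop :=
  forall V, V \in sub_vertices S -> exists k : nat, (k%:R <= r)%R /\ reach S k V.

End Maps.

(* Main.v *)
Require Import Defs.
From mathcomp Require Import all_boot all_order all_algebra all_fingroup.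
From mathcomp Require Import zify ring lra.
Import Order.TTheory GRing.Theory Num.Theory.
Set Implicit Arguments. Unset Strict Implicit. Unset Printing Implicit Defensive.

(* Let P(S) be the perimeter of a region S whose complement is connected, and
   let [peel S] be obtained from S by removing the faces meeting its boundary.
   Comparing Euler characteristics of S and of the full subcomplex spanned by
   its interior vertices gives, in nonpositive curvature,
     q P(peel S) + 2p (excess degree of interior vertices of S)
       + q (excess degree of the faces of S and of peel S) <= q P(S),
   and at most (q/p) P(S) faces are removed.  Summed over all layers, the first
   inequality bounds the sum, over the non-flat vertices and faces, of their
   depths by a multiple of the perimeter.  Hence joining each of them to the
   boundary by a chain of stars of vertices, one per layer, and deleting these
   stars, leaves a flat region T of perimeter O(n), at the cost of O(n) faces.
   A cell of the m-th layer of T lies in a dual component of T, which is a simple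
   flat submap by a Jordan curve argument over F_2 and has radius at least m; so
   m <= r, and T has at most r + 1 layers of O(n) faces each. *)

(** * Counting in unions of classes of an equivalence relation *)

Section Classes.
Variables (T : finType) (c : T -> {set T}).
Hypothesis cP : forall x y, (y \in c x) = (c y == c x).

Definition saturated (X : {set T}) := {in X, forall x, c x \subset X}.

Lemma mem_cls x : x \in c x.
Proof. by rewrite cP. Qed.

Lemma mem_imcls X x : saturated X -> (c x \in c @: X) = (x \in X).
Proof.
move=> satX; apply/imsetP/idP => [[y yX /eqP]|xX]; last by exists x.
by rewrite -cP => xy; apply: (subsetP (satX y yX)).
Qed.

Lemma saturatedP X x y : saturated X -> x \in X -> y \in c x -> y \in X.
Proof. by move=> satX xX; apply: (subsetP (satX x xX)). Qed.

Lemma saturated_mem X x y : saturated X -> y \in c x -> (y \in X) = (x \in X).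
Proof.
move=> satX yx; apply/idP/idP => ?; last exact: saturatedP yx.
apply: (@saturatedP X y) => //; move: yx; rewrite !cP => /eqP->; exact: eqxx.
Qed.

Lemma saturatedC X : saturated X -> saturated (~: X).
Proof.
move=> satX x; rewrite inE => xX; apply/subsetP => y yx.
by rewrite inE (saturated_mem satX yx).
Qed.

Lemma card_saturated X : saturated X -> #|X| = \sum_(C in c @: X) #|C|.
Proof.
move=> satX; rewrite -sum1_card (partition_big_imset c) /=.
apply: eq_bigr => _ /imsetP[x xX ->]; rewrite -sum1_card; apply: eq_bigl => y.
rewrite cP andbC; case: eqP => //= yx.
by rewrite (@saturated_mem _ x y satX) // cP yx.
Qed.

Lemma card_imcls_setC X : saturated X ->
  #|c @: X| + #|c @: ~: X| = #|c @: [set: T]|.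
Proof.
move=> satX; have satCX := saturatedC satX.
have -> : c @: [set: T] = (c @: X) :|: (c @: ~: X) by rewrite -imsetU setUCr.
rewrite cardsU; suff -> : (c @: X) :&: (c @: ~: X) = set0 by rewrite cards0 subn0.
apply/setP => C; rewrite !inE; apply/negP => /andP[/imsetP[x xX ->]].
by rewrite mem_imcls // inE xX.
Qed.

Lemma card_imclsD (X Y : {set T}) : saturated X -> saturated Y -> Y \subset X ->
  #|c @: X| = #|c @: Y| + #|c @: (X :\: Y)|.
Proof.
move=> satX satY YX.
have -> : c @: X = (c @: Y) :|: (c @: (X :\: Y)).
  by rewrite -imsetU setUC setDE setUIl (setUidPl YX) (setUC (~: Y)) setUCr setIT.
rewrite cardsU; suff -> : (c @: Y) :&: (c @: (X :\: Y)) = set0 by rewrite cards0 subn0.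
apply/setP => C; rewrite !inE; apply/negP => /andP[/imsetP[x xX ->]].
case/imsetP => y; rewrite inE => /andP[yY _] /eqP; rewrite -cP => xy.
by rewrite -(saturated_mem satY xy) xX in yY.
Qed.

(** Every class has at least [k] elements, so the truncated subtraction is exact; this is how degree
    excesses enter the counting. *)
Lemma card_ge_saturated X k : saturated X ->
  {in X, forall x, k <= #|c x|} ->
  k * #|c @: X| + \sum_(C in c @: X) (#|C| - k) = #|X|.
Proof.
move=> satX kX; rewrite card_saturated // mulnC -sum_nat_const -big_split /=.
by apply: eq_bigr => _ /imsetP[x xX ->]; rewrite subnKC // kX.
Qed.

End Classes.

(** * Vertices, edges and faces as classes of darts *)

Section MapBasics.
Variables (D : finType) (alpha sigma : {perm D}).
Hypothesis alpha_neq : forall d, alpha d != d.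
Hypothesis alphaK : forall d, alpha (alpha d) = d.
Local Notation phi := (phi alpha sigma).
Local Notation V := (vertex_of sigma).
Local Notation F := (face_of alpha sigma).

Definition edge_of (x : D) : {set D} := [set x; alpha x].

Lemma phi_inj : injective phi.
Proof. by move=> x y /perm_inj/perm_inj. Qed.

Lemma phi_alpha x : phi (alpha x) = sigma x.
Proof. by rewrite /Defs.phi alphaK. Qed.

Lemma fconnect_cls (f : D -> D) : injective f ->
  forall x y, (y \in [set z | fconnect f x z]) =
    ([set z | fconnect f y z] == [set z | fconnect f x z]).
Proof.
move=> f_inj x y; rewrite inE; apply/idP/eqP => [xy|eq_xy].
  by apply/setP => z; rewrite !inE (same_connect (fconnect_sym f_inj) xy).
by have := in_set (fconnect f y) y; rewrite eq_xy inE connect0.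
Qed.

Lemma vertexP x y : (y \in V x) = (V y == V x).
Proof. exact: fconnect_cls perm_inj x y. Qed.

Lemma faceP x y : (y \in F x) = (F y == F x).
Proof. exact: fconnect_cls phi_inj x y. Qed.

Lemma edgeP x y : (y \in edge_of x) = (edge_of y == edge_of x).
Proof.
apply/idP/eqP => [|<-]; last by rewrite !inE eqxx.
by rewrite !inE => /orP[]/eqP->; rewrite /edge_of ?alphaK // setUC.
Qed.

Lemma mem_vertex x : x \in V x. Proof. by rewrite inE connect0. Qed.
Lemma mem_face x : x \in F x. Proof. by rewrite inE connect0. Qed.

Lemma vertex_sigma x : V (sigma x) = V x.
Proof. by apply/eqP; rewrite -vertexP inE fconnect1. Qed.

Lemma face_phi x : F (phi x) = F x.
Proof. by apply/eqP; rewrite -faceP inE fconnect1. Qed.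

Lemma face_alpha x : F (alpha x) = F (sigma x).
Proof. by rewrite -phi_alpha face_phi. Qed.

Lemma vertex_alpha x : V (alpha x) = V (phi x).
Proof. by rewrite /Defs.phi vertex_sigma. Qed.

Lemma fconnect_closed (f : D -> D) (X : {set D}) : injective f ->
  {in X, forall x, f x \in X} -> {in X, forall x, [set z | fconnect f x z] \subset X}.
Proof.
move=> f_inj fX x xX; apply/subsetP => y; rewrite inE => /iter_findex <-.
by elim: (findex f x y) => //= i IH; apply: fX.
Qed.

Lemma vertex_saturated (X : {set D}) :
  {in X, forall x, sigma x \in X} -> saturated V X.
Proof. exact: fconnect_closed perm_inj. Qed.

Lemma face_saturated (X : {set D}) :
  {in X, forall x, phi x \in X} -> saturated F X.
Proof. exact: fconnect_closed phi_inj. Qed.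

Lemma edge_saturated (X : {set D}) :
  {in X, forall x, alpha x \in X} -> saturated edge_of X.
Proof. by move=> aX x xX; apply/subsetP => y; rewrite !inE => /orP[]/eqP->; rewrite ?aX. Qed.

Lemma card_edge x : #|edge_of x| = 2.
Proof. by rewrite cards2 eq_sym alpha_neq. Qed.

Lemma card_edges (X : {set D}) : saturated edge_of X ->
  #|X| = 2 * #|edge_of @: X|.
Proof.
move=> /(card_saturated edgeP)->; rewrite mulnC -sum_nat_const.
by apply: eq_bigr => _ /imsetP[x _ ->]; rewrite card_edge.
Qed.

Lemma sat_phi (X : {set D}) x : saturated F X -> (phi x \in X) = (x \in X).
Proof. by move=> satX; apply: (saturated_mem faceP satX); rewrite faceP face_phi. Qed.

Lemma sat_sigma (X : {set D}) x : saturated V X -> (sigma x \in X) = (x \in X).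
Proof. by move=> satX; apply: (saturated_mem vertexP satX); rewrite vertexP vertex_sigma. Qed.

End MapBasics.

(** * Incidence matrices over F_2 *)

Section Incidence.
Local Open Scope ring_scope.
Variable T : finType.
Implicit Types (A B : {set {set T}}) (X : {set T}).

(** An entry counts common elements modulo 2. With edges as columns, a loop has zero vertex
    incidence, and an edge bordering one face twice has zero face incidence. *)
Definition incidence A B : 'M['F_2]_(#|A|, #|B|) :=
  \matrix_(i < #|A|, j < #|B|)
    \sum_(x in (enum_val j : {set T})) (x \in (enum_val i : {set T}))%:R.

Definition chain_val A (u : 'rV['F_2]_#|A|) (x : T) : 'F_2 :=
  \sum_(i < #|A|) u 0 i * (x \in (enum_val i : {set T}))%:R.

Lemma F2_addrr (a : 'F_2) : a + a = 0.
Proof. exact: addrr_pchar2 (pchar_Fp _) a. Qed.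

Lemma F2_addr_eq0 (a b : 'F_2) : a + b = 0 -> a = b.
Proof. by move/eqP; rewrite addr_eq0 oppr_pchar2 ?pchar_Fp // => /eqP. Qed.

Lemma mul_incidence A B (u : 'rV_#|A|) j :
  (u *m incidence A B) 0 j = \sum_(x in (enum_val j : {set T})) chain_val u x.
Proof.
rewrite mxE exchange_big /=; apply: eq_bigr => i _.
by rewrite mxE mulr_sumr.
Qed.

Variable c : T -> {set T}.
Hypothesis cP : forall x y, (y \in c x) = (c y == c x).

Lemma enum_val_cls X (i : 'I_#|c @: X|) x :
  x \in (enum_val i : {set T}) -> enum_val i = c x.
Proof.
by case/imsetP: (enum_valP i) => y _ ->; rewrite cP => /eqP.
Qed.

Lemma chain_val_enum X (u : 'rV_#|c @: X|) i x :
  x \in (enum_val i : {set T}) -> chain_val u x = u 0 i.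
Proof.
move=> xi; rewrite /chain_val (bigD1 i) //= xi mulr1 big1 ?addr0 // => k ki.
case: (boolP (x \in (enum_val k : {set T}))) => [xk|_]; last by rewrite mulr0.
by case/eqP: ki; apply: enum_val_inj; rewrite (enum_val_cls xi) (enum_val_cls xk).
Qed.

Lemma chain_val_notin X (u : 'rV_#|c @: X|) x :
  saturated c X -> x \notin X -> chain_val u x = 0.
Proof.
move=> satX xX; rewrite /chain_val big1 // => k _.
case: (boolP (x \in (enum_val k : {set T}))) => [xk|_]; last by rewrite mulr0.
by have := enum_valP k; rewrite (enum_val_cls xk) mem_imcls // (negbTE xX).
Qed.

Lemma chain_val_cls X (u : 'rV_#|c @: X|) x y :
  c x = c y -> chain_val u x = chain_val u y.
Proof.
by move=> xy; apply: eq_bigr => i _; case/imsetP: (enum_valP i) => z _ ->; rewrite !cP xy.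
Qed.

End Incidence.

(** Constant vectors span a line, so the kernel has rank at most one. *)
Lemma const_kernel_rank (K : fieldType) m n (N : 'M[K]_(m, n)) :
  (forall u : 'rV_m, (u *m N = 0)%R -> forall i j, u 0%R i = u 0%R j) ->
  m <= (\rank N).+1.
Proof.
move=> constN; suff : \rank (kermx N) <= 1.
  by rewrite mxrank_ker; have := rank_leq_row N; lia.
apply: leq_trans (mxrankS _) (rank_leq_row (const_mx 1%R : 'rV[K]_m)).
apply/row_subP => i; have /constN rowi : (row i (kermx N) *m N = 0)%R.
  by rewrite -row_mul mulmx_ker; apply/rowP => j; rewrite !mxE.
apply/sub_rVP; case: m N constN i rowi => [|m] N _ i rowi; first by have := ltn_ord i.
exists (row i (kermx N) 0%R ord0); apply/rowP => j.
by rewrite (rowi j ord0) !mxE mulr1.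
Qed.

(** * Homology of the sphere modulo 2, and Euler inequalities *)

Section Planar.
Variables (D : finType) (alpha sigma : {perm D}).
Hypothesis M_map : is_map alpha sigma.
Local Notation phi := (phi alpha sigma).
Local Notation V := (vertex_of sigma).
Local Notation F := (face_of alpha sigma).
Local Notation E := (edge_of alpha).

Lemma map_alpha_neq d : alpha d != d. Proof. by case: M_map. Qed.
Lemma map_alphaK d : alpha (alpha d) = d. Proof. by case: M_map. Qed.
Local Notation alphaK := map_alphaK.
Local Notation VP := (vertexP sigma).
Local Notation FP := (faceP alpha sigma).
Local Notation EP := (edgeP alphaK).

Lemma map_connected (W : {set D}) x : x \in W ->
  {in W, forall y, sigma y \in W} -> {in W, forall y, alpha y \in W} ->
  forall y, y \in W.
Proof.
move=> xW sW aW y; case: M_map => _ _ /(_ x y)/connectP[s + ->] _.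
elim: s x xW => //= z s IH x xW /andP[/orP[]/eqP-> ?]; apply: IH => //.
  exact: sW.
exact: aW.
Qed.

Lemma map_connected_phi (W : {set D}) x : x \in W ->
  {in W, forall y, phi y \in W} -> {in W, forall y, alpha y \in W} ->
  forall y, y \in W.
Proof.
move=> xW pW aW; apply: (map_connected xW) => // y yW.
by rewrite -(phi_alpha sigma alphaK); apply/pW/aW.
Qed.

Lemma euler : 2 * (#|V @: [set: D]| + #|F @: [set: D]|) = #|D| + 4.
Proof.
have full (c : D -> {set D}) : c @: [set: D] = [set c d | d : D].
  by apply/setP => C; apply/imsetP/imsetP => [][x _ ->]; exists x.
by rewrite !full; case: M_map.
Qed.

Local Open Scope ring_scope.

Lemma chain_edge (A : {set {set D}}) (u : 'rV['F_2]_#|A|) x :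
  \sum_(y in E x) chain_val u y = chain_val u x + chain_val u (alpha x).
Proof. by rewrite big_setU1 ?big_set1 // inE eq_sym map_alpha_neq. Qed.

Lemma incidence_edge_kernel (A : {set {set D}}) (Es : {set D}) (u : 'rV_#|A|) :
  u *m incidence A (E @: Es) = 0 ->
  {in Es, forall x, chain_val u (alpha x) = chain_val u x}.
Proof.
move=> uN x xE; have Ex : E x \in E @: Es by apply: imset_f.
move/rowP/(_ (enum_rank_in Ex (E x))): uN.
by rewrite mul_incidence enum_rankK_in // chain_edge mxE => /F2_addr_eq0.
Qed.

(** On the edge of [x] the first factor is symmetric under [alpha], so the product splits according
    to the dart at which [b] is evaluated. *)
Lemma sum_edges (Es : {set D}) (a b : D -> 'F_2) : saturated E Es ->
  \sum_(j < #|E @: Es|) (\sum_(x in (enum_val j : {set D})) a x) *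
    (\sum_(x in (enum_val j : {set D})) b x) =
  \sum_(x in Es) (a x + a (alpha x)) * b x.
Proof.
move=> satE; rewrite [RHS](partition_big_imset E) [RHS]big_enum_val /=.
apply: eq_bigr => j _; case/imsetP: (enum_valP j) => x xE ->.
rewrite mulr_sumr [RHS](eq_bigl (mem (E x))); last first.
  move=> y /=; rewrite EP andbC; case: eqP => //= yx.
  by rewrite (@saturated_mem _ _ EP _ x y satE) // EP yx.
apply: eq_bigr => y; rewrite EP => /eqP yx; congr (_ * _); rewrite -yx.
by rewrite big_setU1 ?big_set1 // inE eq_sym map_alpha_neq.
Qed.

(** The boundary of a boundary vanishes. Since [Es] contains all edges at the vertices of [Vs], this
    remains true for an open union of cells. *)
Lemma face_vertex_incidence (Vs Es Fs : {set D}) :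
  saturated V Vs -> saturated E Es -> Vs \subset Es ->
  incidence (F @: Fs) (E @: Es) *m (incidence (V @: Vs) (E @: Es))^T = 0.
Proof.
move=> satV satE VE; apply/matrixP => i k; rewrite !mxE.
under eq_bigr => j _ do rewrite !mxE.
rewrite (sum_edges (fun x => (x \in (enum_val i : {set D}))%:R)
  (fun x => (x \in (enum_val k : {set D}))%:R) satE).
have Vk x : x \in (enum_val k : {set D}) -> x \in Vs.
  case/imsetP: (enum_valP k) => y yV -> ; exact: saturatedP satV yV.
transitivity (\sum_(x in (enum_val k : {set D}))
    ((x \in (enum_val i : {set D}))%:R + (alpha x \in (enum_val i : {set D}))%:R : 'F_2)).
  rewrite big_mkcond [RHS]big_mkcond /=; apply: eq_bigr => x _.
  case: (boolP (x \in (enum_val k : {set D}))) => xk; last by rewrite mulr0 if_same.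
  by rewrite mulr1 (subsetP VE) ?Vk.
(* [alpha x] and [sigma x] lie on the same face, and [sigma] permutes the darts at a vertex; so the
   two sums coincide and cancel modulo 2. *)
rewrite big_split /= [X in _ + X = _](_ : _ = \sum_(x in (enum_val k : {set D}))
    (sigma x \in (enum_val i : {set D}))%:R).
  rewrite [X in X + _ = _](reindex_inj (@perm_inj _ sigma)) /=.
  rewrite [X in X + _ = _](eq_bigl (fun x => x \in (enum_val k : {set D}))) ?F2_addrr // => x.
  by case/imsetP: (enum_valP k) => y _ ->; rewrite !VP vertex_sigma.
apply: eq_bigr => x _; case/imsetP: (enum_valP i) => y _ ->.
by rewrite !FP face_alpha //; apply: alphaK.
Qed.

(** A kernel vector, extended by zero off [Vs], agrees at the two ends of every edge, since an edge
    outside [Es] has no end in [Vs]. The map being connected, it is constant. *)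
Lemma vertex_incidence_rank (Vs Es : {set D}) :
  saturated V Vs -> saturated E Es -> Vs \subset Es ->
  (#|V @: Vs| <= (\rank (incidence (V @: Vs) (E @: Es))).+1)%N.
Proof.
move=> satV satE VE; apply: const_kernel_rank => u uN.
suff cst x y : chain_val u x = chain_val u y.
  move=> i j; case/imsetP: (enum_valP i) (mem_cls VP) => x _ ix /(_ x).
  rewrite -ix => xi; case/imsetP: (enum_valP j) (mem_cls VP) => y _ jy /(_ y).
  by rewrite -jy => yj; rewrite -(chain_val_enum VP u xi) -(chain_val_enum VP u yj).
pose W := [set z | chain_val u z == chain_val u y].
suff : x \in W by rewrite inE => /eqP.
apply: (@map_connected W y); rewrite ?inE // => z; rewrite !inE => /eqP<-.
  by rewrite (chain_val_cls VP u (vertex_sigma sigma z)).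
case: (boolP (z \in Es)) => zE; first by rewrite (incidence_edge_kernel uN).
have azE : alpha z \notin Es.
  by rewrite (saturated_mem EP satE (x := z)) // !inE eqxx orbT.
by rewrite !(chain_val_notin VP u satV) //; apply: contra (subsetP VE _) _.
Qed.

(** The hypothesis says that [Fs] can be reached from [o] across edges of [Es]; a kernel vector does
    not change across such an edge. *)
Lemma face_incidence_rank (Es Fs : {set D}) o :
  (forall W : {set D}, o \in W -> {in W, forall x, phi x \in W} ->
     {in W, forall x, x \in Es -> alpha x \in W} -> Fs \subset W) ->
  (#|F @: Fs| <= (\rank (incidence (F @: Fs) (E @: Es))).+1)%N.
Proof.
move=> connF; apply: const_kernel_rank => u uN.
suff cst x : x \in Fs -> chain_val u x = chain_val u o.
  move=> i j; case/imsetP: (enum_valP i) (mem_cls FP) => x xF ix /(_ x).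
  rewrite -ix => xi; case/imsetP: (enum_valP j) (mem_cls FP) => y yF jy /(_ y).
  rewrite -jy => yj; rewrite -(chain_val_enum FP u xi) -(chain_val_enum FP u yj).
  by rewrite !cst.
pose W := [set z | chain_val u z == chain_val u o] => xF.
suff /subsetP/(_ x xF) : Fs \subset W by rewrite inE => /eqP.
apply: connF; first by rewrite inE.
  by move=> z; rewrite !inE => /eqP<-; rewrite (chain_val_cls FP u (face_phi alpha sigma z)).
by move=> z; rewrite !inE => /eqP<- zE; rewrite (incidence_edge_kernel uN).
Qed.

Local Close Scope ring_scope.

(* An open union of cells has no second homology beyond that of its connected
   set of faces, and the relative zeroth homology is at most that of the whole
   connected map. *)
Lemma open_euler (Vs Es Fs : {set D}) o :
  saturated V Vs -> saturated E Es -> Vs \subset Es ->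
  (forall W : {set D}, o \in W -> {in W, forall x, phi x \in W} ->
     {in W, forall x, x \in Es -> alpha x \in W} -> Fs \subset W) ->
  2 * (#|V @: Vs| + #|F @: Fs|) <= #|Es| + 4.
Proof.
move=> satV satE VE connF.
have rE := mulmx0_rank_max (face_vertex_incidence Fs satV satE VE).
rewrite (card_edges map_alpha_neq alphaK satE); move: rE; rewrite mxrank_tr.
have arith f v rf rv e : f <= rf.+1 -> v <= rv.+1 -> rf + rv <= e ->
  2 * (v + f) <= 2 * e + 4 by lia.
exact: arith (face_incidence_rank connF) (vertex_incidence_rank satV satE VE).
Qed.

(** The two rank bounds together with Euler's formula give the vanishing of the first homology
    modulo 2. *)
Lemma boundary_rank (o : D) :
  #|E @: [set: D]| - \rank (incidence (V @: [set: D]) (E @: [set: D])) <=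
  \rank (incidence (F @: [set: D]) (E @: [set: D])).
Proof.
have satT (c : D -> {set D}) : saturated c [set: D] by move=> *; exact: subsetT.
have conn (W : {set D}) : o \in W -> {in W, forall x, phi x \in W} ->
    {in W, forall x, x \in [set: D] -> alpha x \in W} -> [set: D] \subset W.
  move=> oW pW aW; apply/subsetP => x _; apply: (map_connected_phi oW) => // y yW.
  by apply: aW; rewrite ?inE.
have := euler; rewrite -cardsT (card_edges map_alpha_neq alphaK (satT _)).
have arith f v rf rv e : f <= rf.+1 -> v <= rv.+1 -> 2 * (v + f) = 2 * e + 4 ->
  e - rv <= rf by lia.
apply: arith (face_incidence_rank conn) _.
exact: vertex_incidence_rank (satT _) (satT _) (subsetT _).
Qed.

Lemma cycle_is_boundary (z : 'rV['F_2]_#|E @: [set: D]|) :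
  (z *m (incidence (V @: [set: D]) (E @: [set: D]))^T = 0)%R ->
  exists u : D -> 'F_2, (forall x, u (phi x) = u x) /\
    forall x i, x \in (enum_val i : {set D}) -> (z 0 i = u x + u (alpha x))%R.
Proof.
move=> z0; have [o _|D0] := pickP (@predT D); last first.
  by exists (fun=> 0%R); split=> x; have := D0 x.
have satT (c : D -> {set D}) : saturated c [set: D] by move=> *; exact: subsetT.
set NV := incidence _ _ in z0; set NF := incidence (F @: [set: D]) (E @: [set: D]).
have NFk : (NF <= kermx NV^T)%MS.
  by apply/sub_kermxP; apply: face_vertex_incidence.
have zNF : (z <= NF)%MS.
  apply: (submx_trans (_ : z <= kermx NV^T)%MS); first exact/sub_kermxP.
  (* Face boundaries are cycles, and [boundary_rank] leaves no room for other cycles. *)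
  rewrite -(mxrank_leqif_sup NFk) eqn_leq mxrankS //= mxrank_ker mxrank_tr.
  exact: boundary_rank o.
case/submxP: zNF => u uz; exists (chain_val u); split=> [x|x i xi].
  by apply: (chain_val_cls FP); rewrite face_phi.
by rewrite uz mul_incidence (enum_val_cls EP xi) chain_edge.
Qed.

End Planar.

(** * Peeling off a layer, and the curvature inequality *)

Section Regions.
Variables (D : finType) (alpha sigma : {perm D}).
Hypothesis M_map : is_map alpha sigma.
Local Notation phi := (phi alpha sigma).
Local Notation V := (vertex_of sigma).
Local Notation F := (face_of alpha sigma).
Local Notation alphaK := (map_alphaK M_map).
Local Notation VP := (vertexP sigma).
Local Notation FP := (faceP alpha sigma).
Local Notation phi_alpha := (phi_alpha sigma alphaK).
Implicit Types S T U W : {set D}.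

(** A dart also stands for the corner of its face at its starting vertex. Hence, for a union of
    faces [S], [vcore S] collects the interior vertices, and [peel S] the faces all of whose
    vertices are interior. *)
Definition vcore S : {set D} := [set x | V x \subset S].
Definition peel S : {set D} := [set x | F x \subset vcore S].
Local Notation bdarts := (bdarts alpha).

Definition vexcess q U := \sum_(C in V @: U) (#|C| - q).
Definition fexcess p S := \sum_(C in F @: S) (#|C| - p).

Lemma vcore_sub S : vcore S \subset S.
Proof. by apply/subsetP => x; rewrite inE => /subsetP; apply; apply: mem_vertex. Qed.

Lemma peel_sub_vcore S : peel S \subset vcore S.
Proof. by apply/subsetP => x; rewrite inE => /subsetP; apply; apply: mem_face. Qed.

Lemma peel_sub S : peel S \subset S.
Proof. exact: subset_trans (peel_sub_vcore S) (vcore_sub S). Qed.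

Lemma vcoreS S T : S \subset T -> vcore S \subset vcore T.
Proof. by move=> ST; apply/subsetP => x; rewrite !inE => /subset_trans; apply. Qed.

Lemma vcore_saturated S : saturated V (vcore S).
Proof. by apply: vertex_saturated => x; rewrite !inE vertex_sigma. Qed.

Lemma peel_saturated S : saturated F (peel S).
Proof. by apply: face_saturated => x; rewrite !inE face_phi. Qed.

Lemma sat_alpha S x : saturated F S -> (alpha x \in S) = (sigma x \in S).
Proof. by move=> satS; rewrite -(sat_phi (alpha x) satS) phi_alpha. Qed.

Lemma peel_phi_vcore S x : x \in peel S -> phi x \in vcore S.
Proof.
by rewrite inE => /subsetP; apply; rewrite FP face_phi.
Qed.

Lemma vcore_phi S x : (alpha x \in vcore S) = (phi x \in vcore S).
Proof. by rewrite /Defs.phi (sat_sigma _ (@vcore_saturated S)). Qed.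

Lemma peel_alpha_vcore S x : x \in peel S -> alpha x \in vcore S.
Proof. by rewrite vcore_phi; apply: peel_phi_vcore. Qed.

Lemma bdartsE S x : saturated F S ->
  (x \in bdarts S) = (x \in S) && (sigma x \notin S).
Proof. by move=> satS; rewrite inE sat_alpha. Qed.

(** Turning about the vertex by [sigma] leaves [S] only at a boundary dart; without one, all corners
    at the vertex would be in [S]. *)
Lemma bdarts_at_vertex S x : saturated F S -> x \in S -> x \notin vcore S ->
  exists2 y, y \in V x & y \in bdarts S.
Proof.
move=> satS xS; have [y|noy] := pickP (mem (V x :&: bdarts S)).
  by rewrite /= inE => /andP[yx yb]; exists y.
rewrite inE => /negP[]; apply/subsetP => y yx.
have : y \in [set z in S | z \in V x].
  apply: (saturatedP (vertex_saturated (X := [set z in S | z \in V x]) _) _ yx).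
    move=> z; rewrite !inE => /andP[zS zx].
    have := noy z; rewrite !inE zx /= => noz; apply/andP; split; last first.
      by apply: connect_trans zx (fconnect1 _ _).
    by move: noz; rewrite zS sat_alpha // => /negbFE.
  by rewrite inE xS mem_vertex.
by rewrite inE => /andP[].
Qed.

Lemma card_bdarts_alpha S :
  #|[set x | (x \notin S) && (alpha x \in S)]| = #|bdarts S|.
Proof.
rewrite -(card_imset (mem (bdarts S)) (@perm_inj _ alpha)); apply: eq_card => x.
rewrite inE; apply/andP/imsetP => [[xS axS]|[y]].
  by exists (alpha x); rewrite ?alphaK // inE axS alphaK.
by rewrite inE => /andP[yS ayS] ->; rewrite alphaK.
Qed.

Section Connected.
Variable o : D.

(** Connectedness of [T] in the dual graph, based at [o] and stated as an induction principle. *)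
Definition face_connected T := forall W, o \in W -> {in W, forall x, phi x \in W} ->
  {in W, forall x, x \in T -> alpha x \in T -> alpha x \in W} -> T \subset W.

(** Absence of holes is expressed by the connected complement; the domain itself may be
    disconnected. *)
Definition is_domain S :=
  [/\ saturated F S, o \notin S & face_connected (~: S)].

(* A face outside [peel S] has a corner at a vertex [v] having another corner
   outside [S]; the edges at [v] lead from the latter to the former. *)
Lemma peel_connected S W : is_domain S -> o \in W -> {in W, forall x, phi x \in W} ->
  {in W, forall x, (x \notin vcore S) || (alpha x \notin vcore S) -> alpha x \in W} ->
  ~: peel S \subset W.
Proof.
move=> [satS oS conS] oW pW aW; have satW := face_saturated pW.
have TW : ~: S \subset W.
  apply: conS => // x xW; rewrite inE => xS _; apply: aW => //.
  by rewrite (contra (subsetP (vcore_sub S) x)).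
apply/subsetP => x; rewrite !inE => /subsetPn[y yx yU].
suff yW : y \in W by rewrite -(saturated_mem FP satW yx).
move: yU; rewrite inE => /subsetPn[w wy wS].
have sW : {in W :&: V y, forall z, sigma z \in W :&: V y}.
  move=> z; rewrite inE => /andP[zW zy].
  have sz : sigma z \in V y by rewrite VP vertex_sigma -VP.
  rewrite inE sz andbT -phi_alpha; apply/pW/aW => //; apply/orP; left.
  rewrite (saturated_mem VP (@vcore_saturated S) zy) inE.
  by apply/subsetPn; exists w.
have : y \in W :&: V y; last by rewrite inE => /andP[].
apply: (saturatedP (vertex_saturated sW) (x := w)).
  by rewrite inE wy (subsetP TW) // inE.
by move: wy; rewrite !VP eq_sym.
Qed.

(** An edge bordering a face of [peel S] has both ends in [vcore S]. So an edge with an end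
    elsewhere has both sides outside [peel S], and [peel_connected] applies. *)
Lemma peel_domain S : is_domain S -> is_domain (peel S).
Proof.
move=> domS; have [satS oS conS] := domS; split=> [||W oW pW aW].
- exact: peel_saturated.
- by apply: contra oS; apply/subsetP/peel_sub.
apply: (peel_connected domS) => // x xW xU.
have [xP axP] : x \notin peel S /\ alpha x \notin peel S.
  case/orP: xU => xU; split; apply: contra xU => /[dup] xP.
  - by move=> _; apply: (subsetP (peel_sub_vcore S)).
  - by move/peel_alpha_vcore; rewrite alphaK.
  - by move/peel_alpha_vcore.
  - by move=> _; apply: (subsetP (peel_sub_vcore S)).
by apply: aW; rewrite // inE.
Qed.

(** Comparing [open_euler] for the open complement with Euler's formula shows that the closure of
    [S] has nonnegative Euler characteristic. The left side is twice its number of edges. *)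
Lemma domain_euler S : is_domain S ->
  #|S| + #|bdarts S| <=
  2 * (#|V @: vcore S| + #|V @: (S :\: vcore S)| + #|F @: S|).
Proof.
move=> [satS oS conS].
have vs := @vcore_saturated; have satCS := saturatedC FP satS.
pose Es := [set x | (x \notin S) && (alpha x \notin S)].
have satE : saturated (edge_of alpha) Es.
  by apply: edge_saturated => x; rewrite !inE alphaK andbC.
have VE : vcore (~: S) \subset Es.
  apply/subsetP => x xU; have := subsetP (vcore_sub (~: S)) x xU.
  rewrite !inE => -> /=; rewrite sat_alpha //.
  by move: xU; rewrite -(sat_sigma _ (vs _)) => /(subsetP (vcore_sub _)); rewrite inE.
have := @open_euler _ _ _ M_map _ Es (~: S) o (vs (~: S)) satE VE.
have /[swap]/[apply] : forall W, o \in W -> {in W, forall x, phi x \in W} ->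
  {in W, forall x, x \in Es -> alpha x \in W} -> ~: S \subset W.
  move=> W oW pW aW; apply: conS => // x xW; rewrite !inE => xS axS.
  by apply: aW => //; rewrite inE xS.
have Vle : #|V @: ~: vcore (~: S)| <= #|V @: vcore S| + #|V @: (S :\: vcore S)|.
  apply: leq_trans (leq_card_setU _ _).1; apply: subset_leq_card.
  rewrite -imsetU; apply/subsetP => _ /imsetP[x + ->].
  rewrite !inE => /subsetPn[y yx]; rewrite inE negbK => yS.
  apply/imsetP; exists y; last by apply/esym/eqP; rewrite -VP.
  by rewrite !inE yS andbT orbN.
have := euler M_map; rewrite -(card_imcls_setC VP (vs (~: S))).
rewrite -(card_imcls_setC FP satS).
have -> : #|D| = #|Es| + #|S| + #|bdarts S|.
  rewrite -(cardsC S) -(cardsID [set x | alpha x \in S] (~: S)) -card_bdarts_alpha.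
  have -> : ~: S :&: [set x | alpha x \in S] = [set x | (x \notin S) && (alpha x \in S)].
    by apply/setP => x; rewrite !inE.
  have -> : ~: S :\: [set x | alpha x \in S] = Es.
    by apply/setP => x; rewrite !inE andbC.
  lia.
lia.
Qed.

(** The same argument for the full subcomplex spanned by the interior vertices, whose faces are
    those of [peel S]. *)
Lemma vcore_euler S : is_domain S ->
  #|[set x in vcore S | alpha x \in vcore S]| <=
  2 * (#|V @: vcore S| + #|F @: peel S|).
Proof.
move=> domS; have satU := @vcore_saturated S.
pose Es := [set x | (x \notin vcore S) || (alpha x \notin vcore S)].
have satE : saturated (edge_of alpha) Es.
  by apply: edge_saturated => x; rewrite !inE alphaK orbC.
have VE : ~: vcore S \subset Es.
  by apply/subsetP => x; rewrite in_setC => xU; rewrite inE xU.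
have := @open_euler _ _ _ M_map _ Es (~: peel S) o (saturatedC VP satU) satE VE.
have /[swap]/[apply] : forall W, o \in W -> {in W, forall x, phi x \in W} ->
  {in W, forall x, x \in Es -> alpha x \in W} -> ~: peel S \subset W.
  move=> W oW pW aW; apply: (peel_connected domS) => // x xW xU.
  by apply: aW => //; rewrite inE.
have := euler M_map; rewrite -(card_imcls_setC VP satU).
rewrite -(card_imcls_setC FP (@peel_saturated S)) -(cardsC Es).
have -> : ~: Es = [set x in vcore S | alpha x \in vcore S].
  by apply/setP => x; rewrite !in_set negb_or !negbK.
lia.
Qed.

Lemma card_boundary_vertices S : is_domain S ->
  #|V @: (S :\: vcore S)| <= #|bdarts S|.
Proof.
move=> [satS _ _]; apply: leq_trans (leq_imset_card V (mem (bdarts S))).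
apply/subset_leq_card/subsetP => _ /imsetP[x + ->]; rewrite in_setD => /andP[xU xS].
have [y yx yb] := bdarts_at_vertex satS xS xU.
by apply/imsetP; exists y => //; apply/esym/eqP; rewrite -VP.
Qed.

(** Boundary darts, and the reversals of darts leading from interior to other vertices, are distinct
    darts of [S] at non-interior vertices. *)
Lemma card_radial S : is_domain S ->
  #|[set x in vcore S | alpha x \notin vcore S]| + #|bdarts S| <= #|S :\: vcore S|.
Proof.
move=> [satS _ _]; set R := [set x in _ | _].
rewrite -(card_imset (mem R) (@perm_inj _ alpha)).
have <- : #|alpha @: R :|: bdarts S| = #|alpha @: R| + #|bdarts S|.
  apply/eqP; rewrite (leq_card_setU _ _).2; apply/pred0P => x /=.
  apply/negP => /andP[/imsetP[y]]; rewrite !inE => /andP[yU _] -> /andP[_].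
  by rewrite alphaK => /negP; apply; apply: (subsetP yU); apply: mem_vertex.
apply/subset_leq_card/subsetP => x; rewrite in_setU in_setD => /orP[].
  case/imsetP => y; rewrite in_set => /andP[yU ayU] ->.
  rewrite ayU sat_alpha //= -(sat_sigma _ (@vcore_saturated S)) in yU *.
  exact: (subsetP (vcore_sub S)).
rewrite bdartsE // => /andP[xS sx]; rewrite xS andbT; apply: contra sx.
rewrite -(sat_sigma _ (@vcore_saturated S)); exact: (subsetP (vcore_sub S)).
Qed.

Lemma card_peel_boundary S :
  #|bdarts (peel S)| + #|peel S| <= #|[set x in vcore S | alpha x \in vcore S]|.
Proof.
rewrite -(card_imset (mem (bdarts (peel S))) (@perm_inj _ alpha)).
have <- : #|alpha @: bdarts (peel S) :|: peel S| =
    #|alpha @: bdarts (peel S)| + #|peel S|.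
  apply/eqP; rewrite (leq_card_setU _ _).2; apply/pred0P => x /=.
  by apply/negP => /andP[/imsetP[y]]; rewrite in_set => /andP[_ ayS] -> xS; rewrite xS in ayS.
have PU := subsetP (peel_sub_vcore S).
apply/subset_leq_card/subsetP => x; rewrite in_setU => /orP xS; rewrite in_set.
case: xS => [/imsetP[y]|xS]; last by rewrite PU // peel_alpha_vcore.
by rewrite in_set => /andP[yS _] ->; rewrite alphaK peel_alpha_vcore // PU.
Qed.

Definition euclidean_type p q := (p, q) \in [:: (3, 6); (4, 4); (6, 3)].

Definition nonpositive p q S :=
  {in S, forall x, p <= #|F x|} /\ {in vcore S, forall x, q <= #|V x|}.

Lemma peel_nonpositive p q S : nonpositive p q S -> nonpositive p q (peel S).
Proof.
move=> [pS qS]; split=> x xP; first by apply: pS; apply: (subsetP (peel_sub S)).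
by apply: qS; apply: (subsetP (vcoreS (peel_sub S))).
Qed.

(** In a linear combination of the two Euler inequalities and the counts of darts by vertices and by
    faces, the relation between [p] and [q] cancels the numbers of cells; perimeters and excesses
    remain. *)
Lemma peel_step p q S : euclidean_type p q -> is_domain S -> nonpositive p q S ->
  q * #|bdarts (peel S)| + 2 * p * vexcess q (vcore S) +
    q * (fexcess p S + fexcess p (peel S)) <= q * #|bdarts S|
  /\ p * #|F @: (S :\: peel S)| <= q * #|bdarts S|.
Proof.
move=> pq domS [pS qS]; have [satS oS conS] := domS.
have pP : {in peel S, forall x, p <= #|F x|}.
  by move=> x xP; apply: pS; apply: (subsetP (peel_sub S)).
have := card_ge_saturated VP (@vcore_saturated S) qS; rewrite -/(vexcess _ _).
have := card_ge_saturated FP satS pS; rewrite -/(fexcess _ _).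
have := card_ge_saturated FP (@peel_saturated S) pP; rewrite -/(fexcess _ _).
have := card_imclsD FP satS (@peel_saturated S) (peel_sub S).
have := card_peel_boundary S; have := card_radial domS.
have := card_boundary_vertices domS.
have := vcore_euler domS; have := domain_euler domS.
have := cardsID (vcore S) S; rewrite (setIidPr (vcore_sub S)).
have := cardsID [set x | alpha x \in vcore S] (vcore S).
rewrite -setIdE (_ : _ :\: _ = [set x in vcore S | alpha x \notin vcore S]); last first.
  by apply/setP => x; rewrite !in_set andbC.
by move: pq; rewrite /euclidean_type !inE => /or3P[]/eqP[-> ->]; lia.
Qed.

End Connected.
End Regions.

(** * Elementary counting *)

Lemma sum_decreasing_bool (b : nat -> bool) N i :
  (forall k, b k.+1 -> b k) -> i < N -> b i = (i < \sum_(k < N) b k).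
Proof.
move=> bS iN; have bD m n : m <= n -> b n -> b m.
  by move=> mn; rewrite -(subnKC mn); elim: (n - m) => [|d IH]; rewrite ?addn0 ?addnS // => /bS.
rewrite -(big_mkord xpredT (fun k => b k : nat)) (big_cat_nat (n := i)) ?(ltnW iN) //=.
case: (boolP (b i)) => bi.
  rewrite (big_ltn iN) bi (eq_big_nat _ _ (F2 := fun=> 1)); last first.
    by move=> k /andP[_ /ltnW ki]; rewrite (bD _ _ ki bi).
  by rewrite sum_nat_const_nat muln1; lia.
rewrite [X in _ + X]big1_seq => [|k]; last first.
  rewrite mem_index_iota => /andP[_ /andP[ik _]].
  by case bk: (b k) => //; case/negP: bi; apply: bD bk.
apply/esym/negbTE; rewrite -leqNgt addn0.
apply: leq_trans (_ : \sum_(0 <= k < i) 1 <= _); first by apply: leq_sum => k _; case: (b k).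
by rewrite sum_nat_const_nat muln1; lia.
Qed.

(** The number of indices at which [b] holds is its threshold; for nested layers this is the depth
    of a cell. *)
Lemma sum_decreasing_bool_vanish (b : nat -> bool) N :
  (forall k, b k.+1 -> b k) -> ~~ b N -> forall i, b i = (i < \sum_(k < N) b k).
Proof.
move=> bS bN i; have [iN|Ni] := ltnP i N; first exact: sum_decreasing_bool.
have -> : b i = false.
  apply/negbTE; move: bN; rewrite -(subnKC Ni).
  by elim: (i - N) => [|d IH] bN; rewrite ?addn0 // addnS (contra (bS _)) ?IH.
apply/esym/negbTE; rewrite -leqNgt; apply: leq_trans Ni.
by rewrite -[leqRHS]card_ord -sum1_card; apply: leq_sum => k _; case: (b k).
Qed.

Lemma leq_card_bigcup (I T : finType) (P : {set I}) (A : I -> {set T}) :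
  #|\bigcup_(i in P) A i| <= \sum_(i in P) #|A i|.
Proof.
elim/big_rec2: _ => [|i n B _ IH]; first by rewrite cards0.
by apply: leq_trans (leq_card_setU _ _).1 _; rewrite leq_add2l.
Qed.

Lemma leq_sum_subset (I : finType) (A B : {set I}) (f : I -> nat) :
  A \subset B -> \sum_(i in A) f i <= \sum_(i in B) f i.
Proof. by move=> AB; rewrite [leqRHS](big_setID A) /= (setIidPr AB) leq_addr. Qed.

(** * Iterated peeling, and deletion of stars *)

Section FlatPart.
Variables (D : finType) (alpha sigma : {perm D}).
Hypothesis M_map : is_map alpha sigma.
Variable o : D.
Local Notation phi := (phi alpha sigma).
Local Notation V := (vertex_of sigma).
Local Notation F := (face_of alpha sigma).
Local Notation alphaK := (map_alphaK M_map).
Local Notation VP := (vertexP sigma).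
Local Notation FP := (faceP alpha sigma).
Local Notation phi_alpha := (phi_alpha sigma alphaK).
Local Notation bdarts := (bdarts alpha).
Local Notation vcore := (vcore sigma).
Local Notation peel := (peel alpha sigma).
Local Notation is_domain := (is_domain alpha sigma o).
Local Notation vexcess := (vexcess sigma).
Local Notation fexcess := (fexcess alpha sigma).
Local Notation nonpositive := (nonpositive alpha sigma).
Implicit Types S A T W : {set D}.

Lemma iter_peel_domain S i : is_domain S -> is_domain (iter i peel S).
Proof. by elim: i => //= i IH /IH; apply: peel_domain. Qed.

Lemma iter_peel_nonpositive p q S i :
  nonpositive p q S -> nonpositive p q (iter i peel S).
Proof. by elim: i => //= i IH /IH; apply: peel_nonpositive. Qed.

(** If [peel S = S], then [S] is closed under [phi] and [alpha], hence contains all darts, against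
    [o \notin S]. *)
Lemma peel_proper S : is_domain S -> S != set0 -> #|peel S| < #|S|.
Proof.
move=> [satS oS _] /set0Pn[x xS]; rewrite ltn_neqAle subset_leq_card ?peel_sub // andbT.
apply: contra oS => /eqP eqS.
have {}eqS : peel S = S by apply/eqP; rewrite eqEcard peel_sub eqS leqnn.
apply: (map_connected_phi M_map xS) => y; rewrite -{1}eqS => yS.
  exact/(subsetP (vcore_sub sigma S))/peel_phi_vcore.
exact/(subsetP (vcore_sub sigma S))/peel_alpha_vcore.
Qed.

Lemma iter_peel_sub S i : iter i peel S \subset S.
Proof. by elim: i => //= i; apply: subset_trans; apply: peel_sub. Qed.

Lemma iter_peel_eq0 S n : is_domain S -> #|S| <= n -> iter n peel S = set0.
Proof.
elim: n S => [|n IH] S domS; first by rewrite leqn0 cards_eq0 => /eqP.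
case: (eqVneq S set0) => [S0 _|S0 Sn].
  by apply/eqP; rewrite -subset0; move: (iter_peel_sub S n.+1); rewrite S0.
rewrite iterSr; apply: IH; first exact: peel_domain.
by rewrite -ltnS; apply: leq_trans (peel_proper domS S0) Sn.
Qed.

(** [peel_step] telescopes. A cell contributes in every layer that it survives, so excesses are
    weighted by depth. *)
Lemma iter_peel_bdarts p q S i : euclidean_type p q -> is_domain S ->
  nonpositive p q S ->
  q * #|bdarts (iter i peel S)| + 2 * p * \sum_(j < i) vexcess q (vcore (iter j peel S)) +
    q * \sum_(j < i) (fexcess p (iter j peel S) + fexcess p (iter j.+1 peel S)) <=
  q * #|bdarts S|.
Proof.
move=> pq domS npS; elim: i => [|i IH]; first by rewrite !big_ord0 /=; lia.
move: IH; rewrite !big_ord_recr /=.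
have := (peel_step M_map pq (iter_peel_domain i domS) (iter_peel_nonpositive i npS)).1.
lia.
Qed.

(** By [peel_step] each layer has at most [q / p] times the perimeter many faces, and perimeters do
    not increase. *)
Lemma card_faces_iter_peel p q S m : euclidean_type p q -> is_domain S ->
  nonpositive p q S -> iter m peel S = set0 ->
  p * #|F @: S| <= m * (q * #|bdarts S|).
Proof.
move=> pq; elim: m S => [|m IH] S domS npS.
  by move=> /= ->; rewrite imset0 cards0 muln0.
rewrite iterSr => /(IH _ (peel_domain M_map domS) (peel_nonpositive npS)) IHm.
have [satS _ _] := domS.
rewrite (card_imclsD FP satS (@peel_saturated _ _ _ S) (peel_sub _ _ S)).
have [pS fS] := peel_step M_map pq domS npS.
have : m * (q * #|bdarts (peel S)|) <= m * (q * #|bdarts S|).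
  by rewrite leq_mul2l; apply/orP; right; lia.
by lia.
Qed.

Definition star A : {set D} := [set x | ~~ [disjoint F x & A]].

Lemma starP A x : reflect (exists2 y, y \in F x & y \in A) (x \in star A).
Proof.
rewrite inE; apply: (iffP idP) => [/pred0Pn[y /andP[]]|[y yx yA]]; first by exists y.
by apply/pred0Pn; exists y; apply/andP.
Qed.

Lemma star_saturated A : saturated F (star A).
Proof. by apply: face_saturated => x; rewrite !inE face_phi. Qed.

Lemma sub_star A : A \subset star A.
Proof. by apply/subsetP => x xA; apply/starP; exists x => //; apply: mem_face. Qed.

Lemma alpha_star A x : saturated V A -> x \in A -> alpha x \in star A.
Proof.
move=> satA xA; apply/starP; exists (sigma x); last by rewrite sat_sigma.
by rewrite FP -phi_alpha face_phi.
Qed.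

(** Rotation about a vertex of [A] crosses only edges with both sides in the star. *)
Lemma star_vertex_connected A W x y : saturated V A -> {in W, forall x, phi x \in W} ->
  {in W, forall x, x \in star A -> alpha x \in star A -> alpha x \in W} ->
  x \in A -> x \in W -> y \in V x -> y \in W.
Proof.
move=> satA pW aW xA xW yx.
suff : y \in W :&: A by rewrite inE => /andP[].
have sW : {in W :&: A, forall z, sigma z \in W :&: A}.
  move=> z; rewrite !in_setI => /andP[zW zA]; rewrite (sat_sigma z satA) zA andbT -phi_alpha.
  by apply/pW/aW; rewrite ?alpha_star // (subsetP (sub_star A)).
by apply: saturatedP (vertex_saturated sW) _ yx; rewrite inE xW.
Qed.

Lemma card_star_faces S A : #|F @: (S :&: star A)| <= #|A|.
Proof.
apply: leq_trans (leq_imset_card F (mem A)).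
apply/subset_leq_card/subsetP => _ /imsetP[x + ->]; rewrite in_setI => /andP[_ /starP[y yx yA]].
by apply/imsetP; exists y => //; apply/esym/eqP; rewrite -FP.
Qed.

(* A face meeting [A] has two darts adjacent to one of its corners in [A], and
   these two are not on the new boundary; hence the [p - 2]. *)
Lemma card_bdarts_setD_star p S A : 1 < p -> saturated F S -> saturated V A ->
  {in S, forall x, p <= #|F x|} ->
  #|bdarts (S :\: star A)| <=
  #|bdarts S| + (p - 2) * #|F @: (S :&: star A)| + fexcess p S.
Proof.
move=> p1 satS satA pS; have satB := @star_saturated A.
have satG : saturated F (S :&: star A).
  by apply: face_saturated => x; rewrite !in_setI !(sat_phi _ satS, sat_phi _ satB).
(* Darts of deleted faces whose other side survives; their reversals contain all boundary darts not
   inherited from [S]. *)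
pose G' := [set x in S :&: star A | alpha x \in S :\: star A].
have bsub : bdarts (S :\: star A) \subset bdarts S :|: alpha @: G'.
  apply/subsetP => x xb; have := xb; rewrite in_set => /andP[xS axS].
  rewrite in_setU; case: (boolP (alpha x \in S)) => aS; last first.
    by move: xS; rewrite in_setD => /andP[_ xS]; rewrite [x \in bdarts S]in_set xS aS.
  apply/orP; right; apply/imsetP; exists (alpha x); rewrite ?alphaK //.
  by rewrite in_set alphaK xS in_setI aS andbT /=; move: axS; rewrite in_setD aS andbT negbK.
apply: leq_trans (subset_leq_card bsub) _; apply: leq_trans (leq_card_setU _ _).1 _.
rewrite -addnA leq_add2l card_imset; last exact: perm_inj.
apply: leq_trans (_ : \sum_(C in F @: (S :&: star A)) (#|C| - 2) <= _).
  have GG : G' \subset S :&: star A by apply/subsetP => x; rewrite in_set => /andP[].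
  rewrite -sum1_card (partition_big F (mem (F @: (S :&: star A)))) /=; last first.
    by move=> x /(subsetP GG) xG; apply: imset_f.
  apply: leq_sum => _ /imsetP[x xG ->]; rewrite sum1dep_card.
  have := xG; rewrite in_setI => /andP[xS /starP[z zx zA]].
  (* The predecessor [y] of [z] ends, and [z] starts, at a vertex of [A]; hence the far sides of
     both lie in the star. *)
  have zy : z = phi (finv phi z) by rewrite f_finv //; apply: phi_inj.
  set y := finv phi z in zy.
  have Vy : alpha y \in V z by rewrite zy VP vertex_alpha.
  have yx : y \in F x by rewrite FP -face_phi -zy -FP.
  have yz : y != z.
    apply/eqP => yz; have : #|F z| <= 1.
      rewrite -(cards1 z); apply/subset_leq_card/subsetP => w.
      have : saturated F [set z].
        by apply: face_saturated => v; rewrite !inE => /eqP->; rewrite -{1}yz -zy.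
      by move=> sat; apply: saturatedP; rewrite ?inE.
    by rewrite leqNgt (leq_trans p1) // pS // (saturated_mem FP satS zx).
  have bad u : u \in A -> u \notin G' /\ alpha u \notin G'.
    move=> uA; split; apply/negP; rewrite in_set in_setD => /andP[_ /andP[]].
      by rewrite alpha_star.
    by rewrite alphaK (subsetP (sub_star A)).
  have zG : z \notin G' by case: (bad z zA).
  have yG : y \notin G'.
    by rewrite -[y]alphaK; case: (bad (alpha y)) => //; apply: saturatedP satA zA Vy.
  have : #|[set u in G' | F u == F x]| + #|[set y; z]| <= #|F x|.
    have <- : #|[set u in G' | F u == F x] :|: [set y; z]| =
        #|[set u in G' | F u == F x]| + #|[set y; z]|.
      apply/eqP; rewrite (leq_card_setU _ _).2; apply/pred0P => u /=.
      apply/negP => /andP[]; rewrite in_set => /andP[uG _]; rewrite !inE => /orP[]/eqP uE.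
        by rewrite uE (negbTE yG) in uG.
      by rewrite uE (negbTE zG) in uG.
    apply/subset_leq_card/subsetP => u; rewrite in_setU in_set => /orP[/andP[_]|].
      by rewrite -FP.
    by rewrite !inE => /orP[]/eqP-> ; move: yx zx; rewrite !inE.
  have sub2 a b : a + 2 <= b -> a <= b - 2 by move=> ab; rewrite -(addnK 2 a) leq_sub2r.
  by rewrite cards2 yz; apply: sub2.
rewrite mulnC -sum_nat_const.
apply: leq_trans (_ : _ <= \sum_(C in F @: (S :&: star A)) (p - 2) +
   \sum_(C in F @: (S :&: star A)) (#|C| - p)) _.
  by rewrite -big_split /=; apply: leq_sum => C _; lia.
by rewrite leq_add2l leq_sum_subset // imsetS // subsetIl.
Qed.

End FlatPart.

(** * Depth and descending chains *)

Section Chains.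
Variables (D : finType) (alpha sigma : {perm D}).
Hypothesis M_map : is_map alpha sigma.
Variable o : D.
Local Notation V := (vertex_of sigma).
Local Notation F := (face_of alpha sigma).
Local Notation VP := (vertexP sigma).
Local Notation FP := (faceP alpha sigma).
Local Notation vcore := (vcore sigma).
Local Notation peel := (peel alpha sigma).
Local Notation is_domain := (is_domain alpha sigma o).
Local Notation vexcess := (vexcess sigma).
Local Notation fexcess := (fexcess alpha sigma).
Local Notation star := (star alpha sigma).
Implicit Types A C T W : {set D}.

Variables (S : {set D}) (N : nat).
Hypothesis domS : is_domain S.
Hypothesis peelN : iter N peel S = set0.

Local Notation layer i := (iter i peel S).
Local Notation core i := (vcore (layer i)).

(** Positive exactly on the interior vertices of [S]; the sum may stop at [N], where the core is
    empty. *)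
Definition depth x := \sum_(i < N) (x \in core i).

Lemma core_sub i : core i.+1 \subset core i.
Proof. exact: vcoreS (peel_sub _ _ _). Qed.

Lemma coreN : core N = set0.
Proof. by apply/eqP; rewrite peelN -subset0 vcore_sub. Qed.

Lemma core_depth i x : (x \in core i) = (i < depth x).
Proof.
apply: (sum_decreasing_bool_vanish (b := fun k => x \in core k)) => [k|].
  exact: (subsetP (core_sub k)).
by rewrite coreN inE.
Qed.

Lemma depth_vertex x y : y \in V x -> depth y = depth x.
Proof.
by move=> yx; apply: eq_bigr => i _; rewrite (saturated_mem VP (@vcore_saturated _ _ _) yx).
Qed.

Lemma face_depth x y j : x \in layer j.+1 -> y \in F x -> y \notin core j.+1 ->
  depth y = j.+1.
Proof.
move=> xj yx; have : y \in core j by move: xj; rewrite /= inE => /subsetP/(_ y yx).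
by rewrite !core_depth -leqNgt => ? ?; apply/eqP; rewrite eqn_leq; apply/andP.
Qed.

Definition step_down x y :=
  (depth y == (depth x).-1) && [exists x' in V x, y \in F x'].

(** At a vertex of depth [k.+2] some face was removed in passing to layer [k.+2]. That face has a
    vertex outside [core k.+1], and [face_depth] places this vertex one level lower. *)
Lemma step_down_exists x : 1 < depth x -> exists y, step_down x y.
Proof.
case dx: (depth x) => [|[|k]] // _.
have : x \notin core k.+2 by rewrite core_depth dx ltnn.
rewrite inE => /subsetPn[x' x'x]; rewrite [iter _ _ _]/= inE => /subsetPn[y yx' yU].
exists y; rewrite /step_down dx; apply/andP; split; last by apply/existsP; exists x'; rewrite x'x.
apply/eqP/(face_depth _ yx' yU); apply: (subsetP (vcore_sub sigma _)).
by rewrite core_depth (depth_vertex x'x) dx.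
Qed.

Definition down x := odflt x [pick y | step_down x y].

Lemma downP x : 1 < depth x -> step_down x (down x).
Proof.
move=> /step_down_exists[y xy]; rewrite /down; case: pickP => //= no.
by have := no y; rewrite xy.
Qed.

Lemma depth_iter_down x i : i < depth x -> depth (iter i down x) = depth x - i.
Proof.
elim: i => [|i IH] ix; first by rewrite subn0.
have := IH (ltnW ix) => di; have /downP/andP[/eqP dd _] : 1 < depth (iter i down x).
  by rewrite di ltn_subRL addn1.
by rewrite iterS dd di; lia.
Qed.

(** The chain stops at depth one, where the star already contains a face outside [peel S]. *)
Definition chain x : {set D} := [set iter (i : 'I_(depth x)) down x | i : 'I_(depth x)].

Lemma card_chain x : #|chain x| <= depth x.
Proof. by rewrite (leq_trans (leq_imset_card _ _)) // card_ord. Qed.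

Lemma mem_chain x : 0 < depth x -> x \in chain x.
Proof. by move=> x0; apply/imsetP; exists (Ordinal x0). Qed.

Lemma chain_down x y : y \in chain x -> 1 < depth y -> down y \in chain x.
Proof.
case/imsetP=> i _ ->; rewrite depth_iter_down // ltn_subRL addn1 => ix.
by apply/imsetP; exists (Ordinal ix).
Qed.

Lemma chain_core x y : y \in chain x -> y \in core 0.
Proof.
by case/imsetP=> i _ ->; rewrite core_depth depth_iter_down // subn_gt0.
Qed.

Definition saturation A : {set D} := [set x | V x \in V @: A].

Lemma saturationP A x : reflect (exists2 y, y \in A & x \in V y) (x \in saturation A).
Proof.
rewrite inE; apply: (iffP imsetP) => -[y yA].
  by move=> yx; exists y => //; rewrite VP yx.
by rewrite VP => /eqP; exists y.
Qed.

Lemma saturation_saturated A : saturated V (saturation A).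
Proof. by apply: vertex_saturated => x; rewrite !inE vertex_sigma. Qed.

Lemma card_saturation A : #|V @: saturation A| <= #|A|.
Proof.
apply: leq_trans (leq_imset_card V (mem A)).
by apply/subset_leq_card/subsetP => _ /imsetP[x + ->]; rewrite inE.
Qed.

(** Induction on depth: a star at depth one contains a face outside [peel S], and a deeper star
    shares a face with the star of its image under [down]. So deleting these stars keeps the
    complement connected. *)
Lemma chains_connected C :
  {in C, forall x, x \in core 0} -> {in C, forall x, 1 < depth x -> down x \in C} ->
  face_connected alpha sigma o (~: peel S :|: star (saturation C)).
Proof.
move=> C0 Cdown; set A := saturation C; have satA : saturated V A := @saturation_saturated C.
move=> W oW pW aW; have satW := face_saturated pW.
have [_ _ conP] := peel_domain M_map domS.
have PW : ~: peel S \subset W.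
  by apply: conP => // x xW xP axP; apply: aW; rewrite // in_setU ?xP ?axP.
have aW' : {in W, forall x, x \in star A -> alpha x \in star A -> alpha x \in W}.
  by move=> x xW xA axA; apply: aW; rewrite // in_setU ?xA ?axA orbT.
have CW n x : depth x <= n -> x \in C -> V x \subset W.
  elim: n x => [|n IH] x.
    by rewrite leqn0 => /eqP dx /C0; rewrite core_depth dx.
  move=> dxn xC; have xA : x \in A by apply/saturationP; exists x => //; apply: mem_vertex.
  suff [y yx yW] : exists2 y, y \in V x & y \in W.
    apply/subsetP => z zx; apply: (star_vertex_connected M_map satA pW aW' (x := y)) => //.
      exact: saturatedP satA xA yx.
    by move: yx zx; rewrite !VP => /eqP->.
  have [dx|dx] := leqP (depth x) 1.
    have : x \notin core 1 by rewrite core_depth -leqNgt.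
    rewrite inE => /subsetPn[y yx yP]; exists y => //.
    by apply: (subsetP PW); rewrite inE.
  have /andP[/eqP dd /existsP[x' /andP[x'x dF]]] := downP dx.
  exists x' => //; rewrite -(saturated_mem FP satW dF).
  apply: (subsetP (IH (down x) _ _)); [|exact: Cdown|exact: mem_vertex].
  by rewrite dd; lia.
apply/subsetP => x; rewrite in_setU => /orP[/(subsetP PW)//|/starP[y yx /saturationP[c cC yc]]].
rewrite -(saturated_mem FP satW yx); exact: (subsetP (CW _ _ (leqnn _) cC)).
Qed.

Definition fdepth x := \sum_(i < N) (x \in layer i.+1).

Lemma layer_fdepth i x : (x \in layer i.+1) = (i < fdepth x).
Proof.
apply: (sum_decreasing_bool_vanish (b := fun k => x \in layer k.+1)) => [k|].
  exact: (subsetP (peel_sub _ _ _)).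
by rewrite /= peelN; apply/negP => /(subsetP (peel_sub _ _ _)); rewrite inE.
Qed.

Lemma fdepth_face x y : y \in F x -> fdepth y = fdepth x.
Proof.
by move=> yx; apply: eq_bigr => i _; rewrite (saturated_mem FP (@peel_saturated _ _ _ _) yx).
Qed.

(** Lets a face be joined to the boundary by a chain no longer than its own depth. *)
Lemma depth_fdepth x : x \in peel S -> exists2 y, y \in F x & depth y = fdepth x.
Proof.
rewrite -[peel S]/(layer 1) layer_fdepth; case fx: (fdepth x) => [|k] // _.
have : x \notin layer k.+2 by rewrite layer_fdepth fx ltnn.
rewrite [iter _ _ _]/= inE => /subsetPn[y yx yU]; exists y => //.
by apply: face_depth yx yU; rewrite layer_fdepth fx.
Qed.

(** * Chains from the non-flat cells *)

Section Seeds.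
Variables p q : nat.

Let Xv := [set B in V @: core 0 | q < #|B|].
Let Xf := [set B in F @: peel S | p < #|B|].
(** One dart for each seed; for a face, it is taken at a vertex of the same depth. The default [o]
    is not reached on seeds. *)
Let rv (B : {set D}) := odflt o [pick x in B].
Let rf (B : {set D}) := odflt o [pick x in B | depth x == fdepth x].

Let rv_mem B : B \in Xv -> rv B \in B.
Proof.
rewrite inE => /andP[/imsetP[x _ ->] _]; rewrite /rv; case: pickP => //= /(_ x).
by rewrite mem_vertex.
Qed.

Let rf_mem B : B \in Xf -> rf B \in B /\ depth (rf B) = fdepth (rf B).
Proof.
rewrite inE => /andP[/imsetP[x xP ->] _]; rewrite /rf; case: pickP => [y /andP[? /eqP]|] //.
have [y yx dy] := depth_fdepth xP; move=> /(_ y) /=.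
by rewrite yx dy (fdepth_face yx) eqxx.
Qed.

Definition seed_chains :=
  \bigcup_(B in Xv) chain (rv B) :|: \bigcup_(B in Xf) chain (rf B).

(** A chain from depth [d] has at most [d] darts, and its seed has excess at least one in each of
    [d] layers; exchanging the sums gives the bound. *)
Lemma card_seed_chains :
  #|seed_chains| <= \sum_(i < N) vexcess q (core i) + \sum_(i < N) fexcess p (layer i.+1).
Proof.
apply: leq_trans (leq_card_setU _ _).1 _; apply: leq_add.
  apply: leq_trans (leq_card_bigcup _ _) _.
  apply: leq_trans (leq_sum _ (fun B _ => card_chain (rv B))) _.
  rewrite exchange_big /=; apply: leq_sum => i _.
  rewrite /vexcess big_mkcond [leqRHS]big_mkcond; apply: leq_sum => B _.
  case: ifP => // BX; case: (boolP (rv B \in core i)) => // Bi.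
  have := rv_mem BX; have := BX; rewrite inE => /andP[/imsetP[x _ Bx] qB].
  rewrite {2}Bx VP -Bx => /eqP VB.
  have -> : B \in V @: core i by rewrite -{1}VB imset_f.
  by rewrite subn_gt0.
apply: leq_trans (leq_card_bigcup _ _) _.
apply: leq_trans (leq_sum _ (fun B _ => card_chain (rf B))) _.
apply: (@leq_trans (\sum_(B in Xf) fdepth (rf B))).
  by apply: leq_sum => B /rf_mem[_ ->].
rewrite exchange_big /=; apply: leq_sum => i _.
rewrite /fexcess big_mkcond [leqRHS]big_mkcond; apply: leq_sum => B _.
case: ifP => // BX; case: (boolP (rf B \in peel (layer i))) => // Bi.
have [+ _] := rf_mem BX; have := BX; rewrite inE => /andP[/imsetP[x _ Bx] pB].
rewrite {2}Bx FP -Bx => /eqP FB.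
have -> : B \in F @: layer i.+1 by rewrite -{1}FB imset_f.
by rewrite subn_gt0.
Qed.

Lemma seed_chains_core x : x \in seed_chains -> x \in core 0.
Proof.
by rewrite inE => /orP[]/bigcupP[B _]; apply: chain_core.
Qed.

Lemma seed_chains_down x : x \in seed_chains -> 1 < depth x -> down x \in seed_chains.
Proof.
rewrite !inE => /orP[]/bigcupP[B BX xB] dx; apply/orP; [left|right];
  by apply/bigcupP; exists B => //; apply: chain_down.
Qed.

Lemma seed_vertex x : x \in core 0 -> q < #|V x| -> x \in saturation seed_chains.
Proof.
move=> x0 qx; have BX : V x \in Xv by rewrite inE imset_f.
have := rv_mem BX; set y := rv _ => yx; apply/saturationP; exists y; last first.
  by move: yx; rewrite !VP eq_sym.
rewrite inE; apply/orP; left; apply/bigcupP; exists (V x) => //.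
by apply: mem_chain; rewrite (depth_vertex yx) -core_depth.
Qed.

Lemma seed_face x : x \in peel S -> p < #|F x| -> x \in star (saturation seed_chains).
Proof.
move=> x0 px; have BX : F x \in Xf by rewrite inE imset_f.
have [+ dy] := rf_mem BX; set y := rf _ in dy * => yx.
apply/starP; exists y => //; apply/saturationP; exists y; last exact: mem_vertex.
rewrite inE; apply/orP; right; apply/bigcupP; exists (F x) => //.
by apply: mem_chain; rewrite dy (fdepth_face yx) -layer_fdepth.
Qed.

End Seeds.

End Chains.

(** * Extraction of a flat region of controlled perimeter *)

Lemma sum_consecutive (e : nat -> nat) n :
  \sum_(j < n.+1) (e j + e j.+1) + e n.+1 = e 0 + 2 * \sum_(j < n.+1) e j.+1.
Proof.
elim: n => [|n]; first by rewrite !big_ord_recr !big_ord0 /=; lia.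
by rewrite [in X in _ -> X]big_ord_recr [in X in _ -> _ = X]big_ord_recr /=; lia.
Qed.

Section FlatCore.
Variables (D : finType) (alpha sigma : {perm D}).
Hypothesis M_map : is_map alpha sigma.
Variables (o : D) (p q : nat) (S : {set D}).
Local Notation V := (vertex_of sigma).
Local Notation F := (face_of alpha sigma).
Local Notation VP := (vertexP sigma).
Local Notation FP := (faceP alpha sigma).
Local Notation bdarts := (bdarts alpha).
Local Notation vcore := (vcore sigma).
Local Notation peel := (peel alpha sigma).
Local Notation is_domain := (is_domain alpha sigma o).

(** [T] is [peel S] without the stars of the seed chains. This removes every non-flat cell, and
    [chains_connected] keeps the complement connected. *)
Lemma flat_core : euclidean_type p q -> is_domain S -> nonpositive alpha sigma p q S ->
  exists T : {set D}, [/\ is_domain T,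
    {in T, forall x, #|F x| = p}, {in vcore T, forall x, #|V x| = q},
    #|bdarts T| <= 8 * #|bdarts S| & #|F @: S| <= #|F @: T| + 9 * #|bdarts S|].
Proof.
move=> pq domS npS; have [satS oS _] := domS; have [pS qS] := npS.
have peelN := iter_peel_eq0 M_map domS (leqnSn #|S|); set N := #|S|.+1 in peelN.
pose C := seed_chains alpha sigma o S N p q; pose A := saturation sigma C.
have satA : saturated V A by apply: saturation_saturated.
have C0 : {in C, forall x, x \in vcore S} by move=> x; apply: seed_chains_core.
have AS : A \subset vcore S.
  apply/subsetP => x /saturationP[y /C0 yS xy].
  by apply: saturatedP yS xy; apply: vcore_saturated.
have satP := @peel_saturated _ alpha sigma S; have satB := @star_saturated _ alpha sigma A.
have satT : saturated F (peel S :\: star alpha sigma A).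
  by apply: face_saturated => x; rewrite !in_setD !(sat_phi _ satP, sat_phi _ satB).
have TP : peel S :\: star alpha sigma A \subset peel S by apply: subsetDl.
have PS := peel_sub alpha sigma S.
have TS := subset_trans TP PS.
have [p1 q0] : 1 < p /\ 0 < q.
  by move: pq; rewrite /euclidean_type !inE => /or3P[]/eqP[-> ->].
have pP : {in peel S, forall x, p <= #|F x|} by move=> x /(subsetP PS)/pS.
have qA : {in A, forall x, q <= #|V x|} by move=> x /(subsetP AS)/qS.
have bT := card_bdarts_setD_star M_map p1 satP satA pP.
have FA := card_star_faces alpha sigma (peel S) A.
have FT : #|F @: peel S| = #|F @: (peel S :\: star alpha sigma A)| +
    #|F @: (peel S :&: star alpha sigma A)|.
  by rewrite (card_imclsD FP satP satT TP) setDDr setDv set0U.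
have FS := card_imclsD FP satS satP PS.
have [bP FSP] := peel_step M_map pq domS npS.
have cA := card_ge_saturated VP satA qA.
have vA : vexcess sigma q A <= vexcess sigma q (vcore S) by apply/leq_sum_subset/imsetS.
have fP : fexcess alpha sigma p (peel S) <= fexcess alpha sigma p S.
  exact/leq_sum_subset/imsetS.
have nA := leq_trans (card_saturation sigma C) (card_seed_chains o peelN p q).
have layers := iter_peel_bdarts M_map N pq domS npS.
have [Lv [Lf [nALvf [layersL vS]]]] : exists Lv Lf, #|V @: A| <= Lv + Lf /\
  (2 * p * Lv + q * (fexcess alpha sigma p S + Lf + Lf) <= q * #|bdarts S| /\
   vexcess sigma q (vcore S) <= Lv).
  exists (\sum_(i < N) vexcess sigma q (vcore (iter i peel S))).
  exists (\sum_(i < N) fexcess alpha sigma p (iter i.+1 peel S)).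
  split=> //; split; last by rewrite big_ord_recl leq_addr.
  (* As the last layer is empty, the face excess of every layer after the first is counted twice. *)
  have fN : fexcess alpha sigma p (iter N peel S) = 0.
    by rewrite peelN /fexcess imset0 big_set0.
  have := sum_consecutive (fun j => fexcess alpha sigma p (iter j peel S)) #|S|.
  by move: layers; rewrite -/N fN [iter 0 _ _]/=; clear; lia.
(* With P the perimeter of [S], the worst type is [(3, 6)]: there [A] has at most [7 P] darts, which
   gives [P + 7 P] boundary darts and [2 P + 7 P] lost faces. *)
have bound : #|bdarts (peel S :\: star alpha sigma A)| <= 8 * #|bdarts S| /\
    #|F @: S| <= #|F @: (peel S :\: star alpha sigma A)| + 9 * #|bdarts S|.
  move: bT FA FT FS bP FSP cA vA fP nALvf layersL vS; rewrite -/(vexcess _ _ _).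
  clear -pq; move: pq; rewrite /euclidean_type !inE => /or3P[]/eqP[-> ->]; lia.
case: bound => bT' FT'; exists (peel S :\: star alpha sigma A); split=> //.
- split=> //; first by apply: contra oS; apply: (subsetP TS).
  rewrite setCD; apply: (chains_connected M_map domS peelN) => //.
  by move=> x; apply: seed_chains_down.
- move=> x xT; apply/eqP; rewrite eqn_leq pS ?(subsetP TS) // andbT leqNgt.
  move: xT; rewrite in_setD => /andP[xA xP]; apply: contra xA.
  exact: seed_face.
- move=> x xT; have xS := subsetP (vcoreS _ TS) x xT.
  apply/eqP; rewrite eqn_leq qS // andbT leqNgt.
  have := subsetP (vcore_sub sigma _) x xT; rewrite in_setD => /andP[xA _].
  by apply: contra xA => qx; apply/(subsetP (sub_star _ _ _))/seed_vertex.
Qed.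

End FlatCore.

(** * A Jordan curve argument for simple boundaries *)

Section Jordan.
Variables (D : finType) (alpha sigma : {perm D}).
Hypothesis M_map : is_map alpha sigma.
Local Notation phi := (phi alpha sigma).
Local Notation V := (vertex_of sigma).
Local Notation F := (face_of alpha sigma).
Local Notation E := (edge_of alpha).
Local Notation alphaK := (map_alphaK M_map).
Local Notation VP := (vertexP sigma).
Local Notation EP := (edgeP alphaK).
Local Notation bdarts := (bdarts alpha).
Local Notation face_connected := (face_connected alpha sigma).

Section Boundary.
Variables (S : {set D}) (i0 o : D).
Hypotheses (satS : saturated F S) (iS : i0 \in S) (oS : o \notin S).
Hypotheses (conS : face_connected i0 S) (conC : face_connected o (~: S)).

(** The choice depends on the vertex only, so a cycle of [next_bdart] visits no vertex twice. *)
Definition bdart_of (B : {set D}) := odflt i0 [pick y in B | y \in bdarts S].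
Definition next_bdart x := bdart_of (V (alpha x)).

Lemma next_bdartP x : x \in bdarts S ->
  next_bdart x \in V (alpha x) /\ next_bdart x \in bdarts S.
Proof.
rewrite inE => /andP[xS axS]; rewrite /next_bdart.
have pS : phi x \in S by rewrite sat_phi.
have pU : phi x \notin vcore sigma S.
  rewrite inE; apply/subsetPn; exists (alpha x) => //.
  by rewrite -vertex_alpha mem_vertex.
have [y yx yb] := bdarts_at_vertex M_map satS pS pU; rewrite /bdart_of.
by case: pickP => [z /andP[]|/(_ y)] //=; rewrite vertex_alpha yx yb.
Qed.

Lemma bdarts_neq0 : exists x, x \in bdarts S.
Proof.
apply/set0Pn/negP => /eqP b0; case/negP: oS.
apply: (map_connected_phi M_map iS) => x xS; first by rewrite sat_phi.
apply/negPn/negP => axS; have : x \in bdarts S by rewrite inE xS axS.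
by rewrite b0 inE.
Qed.

Lemma iter_next_bdart x n : x \in bdarts S -> iter n next_bdart x \in bdarts S.
Proof. by move=> xb; elim: n => //= n /next_bdartP[]. Qed.

(** [next_bdart] need not be injective, and its orbits are only eventually periodic; the cycle
    starts at the point where an orbit returns. *)
Lemma next_bdart_cycle :
  exists2 x, x \in bdarts S & fcycle next_bdart (fingraph.orbit next_bdart x).
Proof.
have [x xb] := bdarts_neq0; set f := next_bdart.
have /trajectP[i io ix] := looping_order f x.
exists (iter i f x); first exact: iter_next_bdart.
apply/(orbitPcycle 3 0); exists (fingraph.order f x - i).-1.
by rewrite prednK ?subn_gt0 // -iterD subnK ?(ltnW io).
Qed.

(* A closed simple path in the boundary bounds a set of faces modulo 2; as [S]
   and its complement are connected, this set is one of them, and the path is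
   the whole boundary. *)
Lemma bdarts_simple : simple_boundary alpha sigma S.
Proof.
have [x0 x0b cyc] := next_bdart_cycle; set f := next_bdart in cyc.
set s := fingraph.orbit f x0 in cyc.
have sb x : x \in s -> x \in bdarts S.
  by rewrite -fconnect_orbit => /iter_findex <-; apply: iter_next_bdart.
have f_inj : {in s &, injective f} by apply/(orbitPcycle 0 5).
have fs x : x \in s -> f x \in s by apply: fingraph.mem_orbit.
pose s' := [set x in s].
have fs' : f @: s' = s'.
  apply/eqP; rewrite eqEcard card_in_imset ?leqnn ?andbT.
    by apply/subsetP => _ /imsetP[x + ->]; rewrite !inE; apply: fs.
  by move=> x y; rewrite !inE; apply: f_inj.
have sum_s' (B : {set D}) : saturated V B ->
    (\sum_(x in s') (x \in B)%:R = \sum_(x in s') (alpha x \in B)%:R :> 'F_2)%R.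
  move=> satB; rewrite -{1}fs' big_imset /=; last first.
    by move=> x y; rewrite !inE; apply: f_inj.
  apply: eq_bigr => x; rewrite inE => /sb/next_bdartP[fx _].
  by rewrite (saturated_mem VP satB fx).
have satT (c : D -> {set D}) : saturated c [set: D] by move=> *; apply: subsetT.
(* The path as a chain of edges modulo 2; the function [u] below colors the faces so that the color
   changes exactly across [z]. *)
pose z : 'rV['F_2]_#|E @: [set: D]| :=
  (\row_i \sum_(x in (enum_val i : {set D})) (x \in s')%:R)%R.
have z0 : (z *m (incidence (V @: [set: D]) (E @: [set: D]))^T = 0)%R.
  apply/rowP => k; rewrite !mxE; under eq_bigr => j _ do rewrite !mxE.
  pose a x : 'F_2 := ((x \in (enum_val k : {set D}))%:R)%R.
  pose b x : 'F_2 := ((x \in s')%:R)%R.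
  under eq_bigr => j _ do rewrite mulrC.
  rewrite (sum_edges M_map a b (satT _)).
  transitivity (\sum_(x in s') (a x + a (alpha x)))%R.
    rewrite [RHS]big_mkcond /=; apply: eq_big => x; first by rewrite inE.
    by move=> _; rewrite /b; case: (x \in s'); rewrite ?mulr1 ?mulr0.
  rewrite big_split /= /a -sum_s' ?F2_addrr //.
  case/imsetP: (enum_valP k) => y _ -> x xy; apply/subsetP => w.
  by move: xy; rewrite !VP => /eqP->.
have [u [u_phi uz]] := cycle_is_boundary M_map z0.
have us x : ((x \in s)%:R + (alpha x \in s)%:R = u x + u (alpha x) :> 'F_2)%R.
  have Ex : E x \in E @: [set: D] by apply: imset_f.
  have xE : x \in (enum_val (enum_rank_in Ex (E x)) : {set D}).
    by rewrite enum_rankK_in // (mem_cls EP).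
  rewrite -(uz x _ xE) mxE enum_rankK_in //.
  by rewrite big_setU1 ?big_set1 ?inE //= eq_sym (map_alpha_neq M_map).
have nots x : (x \in S) = (alpha x \in S) -> u (alpha x) = u x.
  move=> xS; apply/esym/F2_addr_eq0; rewrite -us.
  have -> : x \in s = false by apply/negP => /sb; rewrite inE xS => /andP[->].
  have -> : alpha x \in s = false; last by rewrite addr0.
  by apply/negP => /sb; rewrite inE alphaK xS => /andP[->].
have uS x : x \in S -> u x = u i0.
  move=> xS; have /subsetP/(_ x xS) : S \subset [set y | u y == u i0].
    apply: conS => [|y|y]; rewrite !inE ?u_phi // => /eqP<- yS ayS.
    by rewrite nots // yS ayS.
  by rewrite inE => /eqP.
have uC x : x \notin S -> u x = u o.
  move=> xS; have /subsetP/(_ x) : ~: S \subset [set y | u y == u o].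
    apply: conC => [|y|y]; rewrite !inE ?u_phi // => /eqP<- yS ayS.
    by rewrite nots // (negbTE yS) (negbTE ayS).
  by rewrite !inE => /(_ xS)/eqP.
(* The reversal of [x0] is outside [S], hence not on the path, so the color changes across [x0]. *)
have uio : (u i0 + u o = 1)%R.
  have := us x0; have := x0b; rewrite inE => /andP[x0S ax0S].
  rewrite (uS x0) // (uC (alpha x0)) // => <-; rewrite fingraph.in_orbit.
  by rewrite (contraNF (@sb _)) ?addr0 // inE (negbTE ax0S).
exists s; split.
- by apply/negP => /eqP s0; have := fingraph.in_orbit f x0; rewrite -/s s0.
- exact: fingraph.orbit_uniq.
- apply/eqP; rewrite eqEsubset; apply/andP; split; apply/subsetP => x.
    by rewrite inE => /sb.
  (* The color changes across every boundary dart, which must therefore lie on the path. *)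
  rewrite !inE => /andP[xS axS]; have := us x.
  rewrite (uS x) // (uC (alpha x)) // uio.
  rewrite [alpha x \in s](contraNF (@sb _)) ?addr0 ?inE ?(negbTE axS) //.
  by case: (x \in s).
- apply: sub_in_cycle cyc => [x y|]; last by apply/allP => x; apply: sb.
  by move=> xb _ /eqP <-; case: (next_bdartP xb).
- have bV x : x \in s -> x = bdart_of (V x).
    rewrite -[x \in s]in_set -/s' -fs' => /imsetP[y]; rewrite inE => /sb yb ->.
    have [] := next_bdartP yb; rewrite VP => /eqP fy _.
    by rewrite /f fy.
  rewrite map_inj_in_uniq ?fingraph.orbit_uniq // => x y xs ys Vxy.
  by rewrite (bV x xs) (bV y ys) Vxy.
Qed.

End Boundary.
End Jordan.

(** * Dual components and their radius *)

Section Radius.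
Variables (D : finType) (alpha sigma : {perm D}).
Hypothesis M_map : is_map alpha sigma.
Variable o : D.
Local Notation phi := (phi alpha sigma).
Local Notation V := (vertex_of sigma).
Local Notation F := (face_of alpha sigma).
Local Notation VP := (vertexP sigma).
Local Notation FP := (faceP alpha sigma).
Local Notation vcore := (vcore sigma).
Local Notation peel := (peel alpha sigma).
Local Notation is_domain := (is_domain alpha sigma o).
Implicit Types S T W : {set D}.

(** [S] is the component of [z] in the dual graph of [T]. Its complement is connected because [~: T]
    is, and the other components are joined to [~: T] by connectedness of the map. *)
Lemma domain_component T (z : D) : is_domain T -> z \in T ->
  exists S : {set D}, [/\ z \in S, S \subset T, saturated F S,
    {in S, forall x, alpha x \in T -> alpha x \in S} &
    simple_boundary alpha sigma S].
Proof.
move=> [satT oT conT] zT.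
pose e : rel D := fun a b => (b \in T) && ((b == phi a) || (b == alpha a)).
pose S := [set x | connect e z x].
have zS : z \in S by rewrite inE connect0.
have closS x y : x \in S -> e x y -> y \in S.
  by move=> zx xy; rewrite inE in zx; rewrite inE; apply: connect_trans zx (connect1 xy).
have indS (W : {set D}) : z \in W ->
    {in W & T, forall x y, (y == phi x) || (y == alpha x) -> x \in S -> y \in W} ->
    S \subset W.
  move=> zW eW; have walk s v : v \in S -> v \in W -> path e v s -> last v s \in W.
    elim: s v => //= y s IH v vS vW /andP[/[dup] vy /andP[yT vy'] ys].
    by apply: IH ys; [apply: closS vS vy | apply: (eW v y)].
  by apply/subsetP => x; rewrite inE => /connectP[s zs ->]; apply: walk.
have ST : S \subset T.
  by apply: indS => // x y xT yT.
have pS : {in S, forall x, phi x \in S}.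
  move=> x xS; apply: closS (xS) _.
  apply/andP; split; last by rewrite eqxx.
  by rewrite (sat_phi x satT) (subsetP ST).
have aS : {in S, forall x, alpha x \in T -> alpha x \in S}.
  by move=> x xS axT; apply: closS xS _; rewrite /e axT eqxx orbT.
have satS := face_saturated pS.
have oS : o \notin S by apply: contra oT; apply: (subsetP ST).
exists S; split=> //; apply: (bdarts_simple M_map satS zS oS) => W.
  move=> zW pW aW; apply: indS => // x y xW yT /orP[]/eqP yx xS; rewrite yx in yT *.
    exact: pW.
  by apply: aW => //; apply: aS.
move=> oW pW aW; have TW : ~: T \subset W.
  by apply: conT => // x xW; rewrite !inE => xT axT; apply: aW => //;
    rewrite in_setC; apply/negP => /(subsetP ST); apply/negP.
have all x : x \in S :|: W.
  apply: (map_connected_phi M_map (x := o)) => [|y|y]; rewrite !in_setU ?oW ?orbT //.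
    by case/orP => [/pS->|/pW->] //; rewrite orbT.
  case: (boolP (y \in S)) => yS /= yW.
    case: (boolP (alpha y \in T)) => [/(aS _ yS)->//|ayT].
    by rewrite [_ \in W](subsetP TW) ?orbT // in_setC.
  case: (boolP (alpha y \in S)) => //= ayS.
  by apply: aW; rewrite // in_setC.
apply/subsetP => x; rewrite in_setC => xS.
by have := all x; rewrite in_setU (negbTE xS).
Qed.

(** An edge starting in the core of layer [j.+1] ends in the core of layer [j], and boundary
    vertices of [S] lie in no core; so every layer costs a step. *)
Lemma reach_layer T S k j x : saturated F T ->
  {in S, forall y, alpha y \in T -> alpha y \in S} ->
  x \in vcore (iter j peel T) -> reach alpha sigma S k (V x) -> j < k.
Proof.
move=> satT aS; elim: k j x => [|k IH] j x xj /=.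
  case/imsetP => y; rewrite inE => /andP[yS ayS] Vxy; case/negP: ayS; apply: aS => //.
  rewrite (sat_alpha M_map) //.
  have := subsetP (vcoreS _ (iter_peel_sub alpha sigma T j)) x xj.
  by rewrite inE Vxy => /subsetP; apply; rewrite VP vertex_sigma.
case=> [/(IH _ _ xj)/leqW//|[w [wx _ /IH]]].
case: j xj => [//|j] xj; apply; apply: peel_alpha_vcore.
by apply: (subsetP (vcore_sub sigma _)); rewrite (saturated_mem VP (@vcore_saturated _ _ _) wx).
Qed.

Lemma flat_layers (R : numDomainType) (r : R) p q T m : is_domain T ->
  {in T, forall x, #|F x| = p} -> {in vcore T, forall x, #|V x| = q} ->
  (forall S : {set D}, simple_submap alpha sigma o S -> flat alpha sigma p q S ->
     radius_le alpha sigma S r) ->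
  iter m peel T != set0 -> exists2 k : nat, (k%:R <= r)%R & m <= k.
Proof.
move=> domT pT qT simp /set0Pn[z zm]; have [satT oT _] := domT.
have zT : z \in T by apply: subsetP zm; apply: iter_peel_sub.
have [S [zS ST satS aS bS]] := domain_component domT zT.
have subS : simple_submap alpha sigma o S.
  split=> //; apply/andP; split; first by apply/forall_inP.
  rewrite disjoint_sym; apply/pred0P => x /=; apply/negP => /andP[xo xS].
  by case/negP: oT; apply/(subsetP ST); rewrite -(saturated_mem FP satS xo).
have flatS : flat alpha sigma p q S.
  split=> [x /(subsetP ST)/pT//|_ /imsetP[x xS ->] xb]; apply: qT.
  apply: (subsetP (vcoreS _ ST)); apply: contraR xb => xU.
  have [y yx yb] := bdarts_at_vertex M_map satS xS xU.
  by apply/imsetP; exists y => //; apply/esym/eqP; rewrite -VP.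
have [k [kr zk]] := simp S subS flatS (V z) (imset_f _ zS).
(* Layer [m.+1] lies in the core of layer [m], so that [reach_layer] gives [m < k]. *)
exists k => //; case: m zm => [//|m] zm.
exact: reach_layer satT aS (subsetP (peel_sub_vcore _ _ _) z zm) zk.
Qed.

End Radius.

(** * Removal of the small exterior faces *)

Section InitialDomain.
Variables (D : finType) (alpha sigma : {perm D}).
Hypothesis M_map : is_map alpha sigma.
Variables (o : D) (p q : nat).
Hypothesis p3 : 3 <= p.
Hypothesis pq_M : pq_map alpha sigma o p q.
Local Notation F := (face_of alpha sigma).
Local Notation alphaK := (map_alphaK M_map).
Local Notation FP := (faceP alpha sigma).
Local Notation bdarts := (bdarts alpha).
Local Notation outer := (outer alpha sigma o).

(* Only exterior faces can have degree less than [p]; they are put outside of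
   the region, which is then nonpositively curved. *)
Definition large_faces := [set x | (x \notin outer) && (p <= #|F x|)].
Definition small_faces := [set x | (x \notin outer) && (#|F x| < p)].

Lemma large_facesE x : (x \in large_faces) = (x \notin outer) && (p <= #|F x|).
Proof. by rewrite in_set. Qed.

Lemma small_facesE x : (x \in small_faces) = (x \notin outer) && (#|F x| < p).
Proof. by rewrite in_set. Qed.

Lemma outer_saturated : saturated F outer.
Proof. by apply: face_saturated => x; rewrite !FP face_phi. Qed.

Lemma large_faces_saturated : saturated F large_faces.
Proof.
by apply: face_saturated => x; rewrite !large_facesE face_phi (sat_phi _ outer_saturated).
Qed.

Lemma small_face_exterior x : x \in small_faces -> exists2 y, y \in F x & alpha y \in outer.
Proof.
rewrite small_facesE => /andP[xo xp]; have : ~~ interior_face alpha sigma o (F x).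
  by apply/negP => /(pq_M.1); rewrite leqNgt xp.
rewrite negb_and => /orP[]; last first.
  by rewrite negb_forall => /existsP[y]; rewrite negb_imply negbK => /andP[]; exists y.
rewrite in_setD1 imset_f // andbT negbK => /eqP Fo.
by case/negP: xo; rewrite -[Defs.outer _ _ _]Fo mem_face.
Qed.

(** Every small face shares an edge with the outer region, which connects the complement. *)
Lemma large_faces_domain : is_domain alpha sigma o large_faces.
Proof.
split; first exact: large_faces_saturated.
  by rewrite large_facesE mem_face.
move=> W oW pW aW; have satW := face_saturated pW.
have outW : outer \subset W by apply: satW.
apply/subsetP => x; rewrite in_setC => xL.
have [/(subsetP outW)//|xo] := boolP (x \in outer).
have xs : x \in small_faces by move: xL; rewrite large_facesE small_facesE xo -ltnNge.
have [y yx ayo] := small_face_exterior xs.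
rewrite -(saturated_mem FP satW yx) -[y]alphaK; apply: aW.
- exact: (subsetP outW).
- by rewrite in_setC large_facesE ayo.
- by rewrite alphaK in_setC (saturated_mem FP large_faces_saturated yx).
Qed.

Lemma large_faces_nonpositive : nonpositive alpha sigma p q large_faces.
Proof.
split=> [x|x]; first by rewrite large_facesE => /andP[].
rewrite in_set => /subsetP xL; apply: pq_M.2; apply/andP; split; first exact: imset_f.
by apply/forall_inP => y /xL; rewrite large_facesE => /andP[].
Qed.

(** A small face is charged to an outer dart on its other side; such darts differ from the outer
    darts facing large faces. *)
Lemma card_small_faces :
  #|[set x in outer | alpha x \in large_faces]| + #|F @: small_faces| <=
  perimeter alpha sigma o.
Proof.
rewrite /perimeter -(cardsID [set x | alpha x \in large_faces] outer) -setIdE leq_add2l.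
apply: leq_trans (leq_imset_card (F \o alpha) (mem (outer :\: [set x | alpha x \in large_faces]))).
apply/subset_leq_card/subsetP => _ /imsetP[x xs ->].
have [y yx ayo] := small_face_exterior xs; apply/imsetP; exists (alpha y).
  rewrite in_setD ayo in_set alphaK andbT (saturated_mem FP large_faces_saturated yx).
  by move: xs; rewrite small_facesE large_facesE => /andP[-> /=]; rewrite ltnNge.
by rewrite /= alphaK; apply/esym/eqP; rewrite -FP.
Qed.

Lemma area_large_faces :
  area alpha sigma o <= #|F @: small_faces| + #|F @: large_faces|.
Proof.
apply: leq_trans (leq_card_setU _ _).1; apply/subset_leq_card/subsetP => B.
rewrite in_setD1 => /andP[Bo /imsetP[x _ Bx]]; rewrite Bx -imsetU imset_f //.
have xo : x \notin outer by rewrite FP -Bx.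
by rewrite in_setU small_facesE large_facesE xo /=; case: ltnP.
Qed.

(** A small face has fewer than [p] sides, at least one of them against the outer region, so at most
    [p - 2] against large faces. As [1 <= p - 2], each outer dart pays for at most [p - 2] boundary
    darts. *)
Lemma card_bdarts_large_faces :
  #|bdarts large_faces| <= (p - 2) * perimeter alpha sigma o.
Proof.
rewrite -(card_bdarts_alpha M_map).
set X := [set x in outer | alpha x \in large_faces].
set Y := [set x in small_faces | alpha x \in large_faces].
have XY : [set x | (x \notin large_faces) && (alpha x \in large_faces)] \subset X :|: Y.
  apply/subsetP => x; rewrite in_set => /andP[+ axL]; rewrite large_facesE => xL.
  rewrite in_setU; apply/orP; case: (boolP (x \in outer)) xL => xo /= xp; [left|right].
    by rewrite in_set xo axL.
  by rewrite in_set axL small_facesE xo ltnNge xp.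
apply: leq_trans (subset_leq_card XY) _; apply: leq_trans (leq_card_setU _ _).1 _.
have YF : #|Y| <= (p - 2) * #|F @: small_faces|.
  rewrite -sum1_card (partition_big F (mem (F @: small_faces))) /=; last first.
    by move=> x; rewrite in_set => /andP[xs _]; apply: imset_f.
  rewrite mulnC -sum_nat_const; apply: leq_sum => _ /imsetP[x xs ->].
  rewrite sum1dep_card; have [y yx ayo] := small_face_exterior xs.
  have yY : y \notin Y by rewrite in_set negb_and large_facesE ayo orbT.
  have cY : #|[set z | (z \in Y) && (F z == F x)]| < #|F x|.
    rewrite (cardsD1 y (F x)) yx add1n ltnS.
    apply/subset_leq_card/subsetP => z; rewrite in_set => /andP[zY zx].
    by rewrite in_setD1 FP zx andbT; apply: contraNN yY => /eqP<-.
  move: xs; rewrite small_facesE => /andP[_ xp].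
  have two_less a b : a < b -> b < p -> a <= p - 2 by clear; lia.
  exact: two_less cY xp.
have := card_small_faces; rewrite -/X => XF.
apply: leq_trans (leq_mul (leqnn (p - 2)) XF).
rewrite mulnDr; apply: leq_add => //; apply: leq_pmull; lia.
Qed.

End InitialDomain.

(** * The three numerical types, and the final estimate *)

Lemma euclidean_typeP (R : realFieldType) p q : 0 < p -> 0 < q ->
  (p%:R^-1 + q%:R^-1 = 2^-1 :> R)%R -> euclidean_type p q.
Proof.
move=> p0 q0 pq; have {}pq : 2 * (p + q) = p * q.
  apply/eqP; rewrite -(eqr_nat R) natrM natrD natrM; apply/eqP.
  have p1 : (p%:R != 0 :> R)%R by rewrite pnatr_eq0 -lt0n.
  have q1 : (q%:R != 0 :> R)%R by rewrite pnatr_eq0 -lt0n.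
  have -> : (p%:R * q%:R = 2 * (p%:R * q%:R * (p%:R^-1 + q%:R^-1)) :> R)%R.
    by rewrite pq; field.
  by field; rewrite p1 q1.
have q3 : 2 < q by case: q q0 pq => [|[|[|q]]] //; clear; lia.
(* The relation reads [(p - 2) * (q - 2) = 4]. *)
have p7 : p < 7 by clear -pq q3; nia.
rewrite /euclidean_type !inE.
case: p p0 pq p7 => [|[|[|[|[|[|[|]]]]]]] //= _ pq _; try by exfalso; clear -pq; lia.
- by have -> : q = 6 by clear -pq; lia.
- by have -> : q = 4 by clear -pq; lia.
- by have -> : q = 3 by clear -pq; lia.
Qed.

Local Open Scope ring_scope.

Theorem theorem2p1 (R : realFieldType) (p q : nat)
    (D : finType) (alpha sigma : {perm D}) (o : D) (r : R) :
  (0 < p)%N -> (0 < q)%N ->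
  (p%:R)^-1 + (q%:R)^-1 = 2^-1 :> R ->
  is_map alpha sigma ->
  pq_map alpha sigma o p q ->
  0 <= r ->
  (forall S : {set D}, simple_submap alpha sigma o S -> flat alpha sigma p q S ->
     radius_le alpha sigma S r) ->
  (area alpha sigma o)%:R
    <= 3 / 2 * (p%:R - 1) * (q%:R + 1) * (r + p%:R) * (perimeter alpha sigma o)%:R.
Proof.
move=> p0 q0 /(euclidean_typeP p0 q0) pq M_map pq_M r0 simp.
have p3 : (3 <= p)%N.
  by move: pq; rewrite /euclidean_type !inE => /or3P[]/eqP[-> _].
have domL := large_faces_domain M_map pq_M.
have npL := large_faces_nonpositive pq_M.
have [T [domT pT qT bT FT]] := flat_core M_map pq domL npL.
have peelT : exists m, iter m (peel alpha sigma) T == set0.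
  by exists #|T|; apply/eqP; apply: (iter_peel_eq0 M_map domT).
have npT : nonpositive alpha sigma p q T.
  by split=> x xT; rewrite ?pT ?qT.
have [m /eqP mT m_min] := ex_minnP peelT.
(* For positive [m], layer [m - 1] is nonempty, whence [m - 1 <= r]. *)
have mr : m%:R <= r + 1.
  case: m mT m_min => [|m] _ m_min; first lra.
  have /(flat_layers M_map domT pT qT simp)[k kr mk] : iter m (peel alpha sigma) T != set0.
    by apply/negP => /m_min; rewrite ltnn.
  by rewrite -natr1 lerD2r (le_trans _ kr) // ler_nat.
have cT := card_faces_iter_peel M_map pq domT npT mT.
have bL := card_bdarts_large_faces M_map p3 pq_M.
have cs := card_small_faces M_map pq_M.
have aL := area_large_faces alpha sigma o p.
set n := perimeter alpha sigma o in bL cs *; set a := area alpha sigma o in aL *.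
have mT' := leq_mul (leqnn m) (leq_trans bT (leq_mul (leqnn 8) bL)).
(* [16 = 8 q (p - 2) / p] for all three types; [37] is the largest value of [1 + 9 (p - 2)],
   attained at [p = 6]. *)
have an : (a <= (37 + 16 * m) * n)%N.
  move: aL cs FT bL cT mT'; clear -pq.
  by move: pq; rewrite /euclidean_type !inE => /or3P[]/eqP[-> ->]; lia.
apply: le_trans (_ : (37 + 16 * m%:R) * n%:R <= _).
  by rewrite -natrM -natrD -natrM ler_nat.
apply: ler_wpM2r => //.
(* As [m <= r + 1], the left factor is at most [16 r + 53]; the right one is at least [21 r + 63],
   its value for [(3, 6)]. *)
move: pq mr r0; rewrite /euclidean_type !inE => /or3P[]/eqP[-> ->]; clear; lra.
Qed.
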